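(* Fix parameters $\alpha,\beta>0$ and a constant $\delta>0$. There exist constants $c_0,c>0$ (depending only on $\alpha,\beta,\delta$) such that the following holds. Let $\boldsymbol{x}\in\mathbb{R}^n$ be a fixed nonzero vector, let $\boldsymbol{a}_1,\dots,\boldsymbol{a}_m$ be independent $\mathcal{N}(\boldsymbol{0},\boldsymbol{I})$ random vectors in $\mathbb{R}^n$, let $y_i=|\boldsymbol{a}_i^T\boldsymbol{x}|^2$ for $i=1,\dots,m$, and suppose $m>c_0n$. Then, with probability exceeding $1-\exp[-cm]$, the solution $\boldsymbol{z}_0$ returned by the tanh weighted spectral method (with its global sign chosen so that $\|\boldsymbol{z}_0-\boldsymbol{x}\|\le\|\boldsymbol{z}_0+\boldsymbol{x}\|$) obeys $$\|\boldsymbol{z}_0-\boldsymbol{x}\|\le\delta\|\boldsymbol{x}\|.$$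
   Context: All vectors are real and $\|\cdot\|$ is the Euclidean norm. The tanh weighted spectral method, with scale factor $\alpha$ and trimming threshold $\beta$, takes as input $\{y_i\}$ and $\{\boldsymbol{a}_i\}$, sets $\hat y=\frac1m\sum_{i=1}^m y_i$, forms the matrix $$\boldsymbol{Y}=\frac1m\sum_{i=1}^m\boldsymbol{a}_i\boldsymbol{a}_i^T\,\tanh\Big(\frac{y_i}{\alpha\hat y}\Big)\,\mathbb{I}(y_i>\beta\hat y),$$ where $\mathbb{I}$ is the indicator function, and returns $\boldsymbol{z}_0=\sqrt{\hat y}\,\boldsymbol{v}$, where $\boldsymbol{v}$ is a unit-norm leading eigenvector (an eigenvector for the largest eigenvalue) of $\boldsymbol{Y}$. (In practice $\boldsymbol{v}$ is computed by power iteration.) *)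

(* Defs.v *)
From HB Require Import structures.
From mathcomp Require Import all_boot all_order all_algebra.
From mathcomp Require Import all_classical all_reals all_analysis.

Set Implicit Arguments.
Unset Strict Implicit.
Unset Printing Implicit Defensive.

Import Order.TTheory GRing.Theory Num.Theory.

Local Open Scope classical_set_scope.
Local Open Scope ring_scope.

(** The norm that the library puts on ['cV[R]_n] is the sup norm. *)
Definition enorm {R : realType} {n : nat} (u : 'cV[R]_n) : R :=
  Num.sqrt (\sum_(j < n) u j ord0 ^+ 2).

Definition inner {R : realType} {n : nat} (u v : 'cV[R]_n) : R :=
  (u^T *m v) ord0 ord0.

Definition tanh {R : realType} (t : R) : R :=
  (expR t - expR (- t)) / (expR t + expR (- t)).

(** [eigenvalue] refers to left eigenvectors; a square matrix has the same left
    and right eigenvalues. *)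
Definition is_leading_eigenvector {R : realType} {n : nat} (A : 'M[R]_n)
    (v : 'cV[R]_n) : Prop :=
  v != 0 /\
  exists2 lambda : R, A *m v = lambda *: v &
    forall mu : R, eigenvalue A mu -> mu <= lambda.

Definition sample_mean {R : realType} {m : nat} (y : 'I_m -> R) : R :=
  m%:R^-1 * \sum_(i < m) y i.

Definition tanh_spectral_mx {R : realType} {m n : nat} (alpha beta : R)
    (y : 'I_m -> R) (a : 'I_m -> 'cV[R]_n) : 'M[R]_n :=
  m%:R^-1 *: \sum_(i < m)
    (tanh (y i / (alpha * sample_mean y)) * (beta * sample_mean y < y i)%R%:R)
      *: (a i *m (a i)^T).

(** A relation rather than a function: a unit leading eigenvector is determined
    only up to sign, and not even that when the top eigenvalue is multiple. *)
Definition tanh_spectral_output {R : realType} {m n : nat} (alpha beta : R)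
    (y : 'I_m -> R) (a : 'I_m -> 'cV[R]_n) (z : 'cV[R]_n) : Prop :=
  exists v : 'cV[R]_n,
    [/\ enorm v = 1,
        is_leading_eigenvector (tanh_spectral_mx alpha beta y a) v
      & z = Num.sqrt (sample_mean y) *: v].

(** Random vectors take values in [n.-tuple R], which carries the product
    sigma-algebra; linear algebra is done on ['cV[R]_n]. *)
Definition col_of_tuple {R : realType} {n : nat} (t : n.-tuple R) : 'cV[R]_n :=
  \col_(j < n) tnth t j.

(** Allowing [B i = setT] makes this equivalent to the product rule for every
    subfamily. *)
Definition mutually_independent {d d' : measure_display} {T : measurableType d}
    {E : measurableType d'} {R : realType} (P : probability T R) {I : finType}
    (X : I -> T -> E) : Prop :=
  (forall i, measurable_fun setT (X i)) /\
  forall B : I -> set E, (forall i, measurable (B i)) ->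
    P (\bigcap_i (X i @^-1` B i)) = (\prod_(i : I) P (X i @^-1` B i))%E.

(** The law N(0, I_n): independent coordinates, each of law N(0, 1); the second
    argument of [normal_prob] is the standard deviation. *)
Definition standard_gaussian_vector {d : measure_display} {T : measurableType d}
    {R : realType} (P : probability T R) {n : nat} (X : T -> n.-tuple R) : Prop :=
  mutually_independent P (fun (j : 'I_n) w => tnth (X w) j) /\
  forall (j : 'I_n) (B : set R), measurable B ->
    P ((fun w => tnth (X w) j) @^-1` B) = normal_prob 0 1 B.

(** Inner probability: for a measurable event [E] this is just [p < P E]. *)
Definition with_probability_exceeding {d : measure_display}
    {T : measurableType d} {R : realType} (P : probability T R) (p : R)
    (E : set T) : Prop :=
  exists A : set T, [/\ measurable A, A `<=` E & (p%:E < P A)%E].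

(* Main.v *)
(** Write [x = r u] with [u] a unit vector, [g_i = <a_i, u>], and let [tau] be
    the mean of the [g_i ^ 2]. The weights of the spectral matrix [Y] are
    [f (g_i ^ 2 / tau)] with [f t = tanh (t / alpha) * 1 (beta < t)], and once
    [|tau - 1| <= t] they are squeezed between the independent weights obtained
    with [1 + t] and [1 - t] in place of [tau]. Only quadratic forms have to be
    bounded, never the cross terms: for a leading unit eigenvector [v],
    [<v, Y v> = lambda >= <u, Y u>] is at least about [A = E (f (g ^ 2) g ^ 2)],
    while every [w] in a finite net of the unit ball satisfies
    [<w, Y w> <= D + <u, w> ^ 2 (A - D) + small] with [D = E (f (g ^ 2))].
    Maximality of [lambda] transfers the second bound from the net to [v], and
    [A > D] because [f] is nondecreasing and [E (g ^ 2 - 1) = 0]; hence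
    [<u, v> ^ 2] is close to [1]. Each bound is a one-sided deviation of a sum of
    independent variables, so Chernoff's inequality and a union bound over the
    net, which has at most [C ^ n] points, conclude. *)

Require Import Defs.
From mathcomp Require Import all_boot all_order all_algebra.
From mathcomp Require Import all_classical all_reals all_analysis.
From mathcomp Require Import measurable_realfun.
From mathcomp Require Import ring lra.
Import Order.TTheory GRing.Theory Num.Theory.
Import numFieldNormedType.Exports.

Set Implicit Arguments.
Unset Strict Implicit.
Unset Printing Implicit Defensive.

Local Open Scope classical_set_scope.
Local Open Scope ring_scope.
(** * Integration against independent variables *)

(** A Gaussian vector is given only through its independent coordinates, so the joint law of
    [<a, u>] and [<a, w>] for orthogonal [u] and [w] has to be derived: shears compose to rotations
    of the plane, these act on pairs of coordinates, and such moves turn [u] and [w] into multiples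
    of two axes. In the Gaussian computations identities with signs are rearranged until every
    integrand is nonnegative, so that Tonelli and additivity apply directly.

    Passing from the net to [v] requires no separate bound on the norm of [Y]: [lambda] dominates
    the quadratic form both at the net point and at the small difference, so the error is relative
    to [lambda]. Every summand is at most [<a, w> ^ 2] in absolute value with [w] in the unit ball,
    hence a single exponential moment, of order 1/8 and at most 4/3, serves all deviations.

    The weights jump at the threshold, so the moments at [1 - t] and [1 + t] are compared by
    dominated convergence, which gives no rate. This is why the gap is fixed before [t] is
    chosen. *)

Section weighted_integral.
Local Open Scope ereal_scope.
Context d d' (T : measurableType d) (E : measurableType d') (R : realType).
Variables (mu : {measure set T -> \bar R}) (nu : {measure set E -> \bar R}).
Variables (h : T -> R) (X : T -> E) (C : R).
Hypotheses (mh : measurable_fun setT h) (h0 : forall x, (0 <= h x)%R).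
Hypothesis mX : measurable_fun setT X.
Hypothesis hX : forall B, measurable B ->
  \int[mu]_(x in X @^-1` B) (h x)%:E = C%:E * nu B.

Import HBNNSimple.

(** By [hX] the image under [X] of the measure with density [h] is [C] times [nu]; simple functions
    and monotone convergence extend this from sets to integrands. Three uses follow: [X] the
    identity and [h] a density, [h = 1] as change of variables, and [h] a product of further factors
    independent of [X]. *)
Lemma ge0_integral_weighted (f : E -> \bar R) : measurable_fun setT f ->
  (forall y, 0 <= f y) ->
  \int[mu]_x ((h x)%:E * f (X x)) = C%:E * \int[nu]_y f y.
Proof.
move=> mf f0.
have mhE : measurable_fun setT (EFin \o h) by exact/measurable_EFinP.
pose g := nnsfun_approx measurableT mf.
have fE y : f y = limn (fun n => (g n y)%:E).
  by apply/esym/cvg_lim => //; exact: cvg_nnsfun_approx.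
have mXB B : measurable B -> measurable (X @^-1` B).
  by move=> mB; rewrite -(setTI (_ @^-1` _)); exact: mX.
have mg n : measurable_fun setT (fun y => (g n y)%:E) by exact/measurable_EFinP.
have mgX n : measurable_fun setT (fun x => (g n (X x))%:E).
  exact: (measurableT_comp (mg n) mX).
have gnd y m n : (m <= n)%N -> (g m y)%:E <= (g n y)%:E.
  by move=> mn; rewrite lee_fin; exact/lefP/nd_nnsfun_approx.
transitivity (limn (fun n => \int[mu]_x ((h x)%:E * (g n (X x))%:E))).
  rewrite -monotone_convergence//.
  - apply: eq_integral => x _; apply/esym/cvg_lim => //.
    apply: cvgeZl; first by [].
    exact: (cvg_nnsfun_approx _ mf).
  - by move=> n; exact: emeasurable_funM.
  - by move=> n x _; rewrite mule_ge0// lee_fin.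
  - by move=> x _ m n mn; rewrite lee_wpmul2l ?lee_fin// -lee_fin gnd.
transitivity (limn (fun n => C%:E * \int[nu]_y (g n y)%:E)); last first.
  under [in RHS]eq_integral do rewrite fE.
  rewrite monotone_convergence//; last 2 first.
  - by move=> n y _; rewrite lee_fin.
  - by move=> y _ m n; exact: gnd.
  apply/cvg_lim => //; apply: cvgeZl => //.
  apply: ereal_nondecreasing_is_cvgn => m n mn.
  by apply: ge0_le_integral => // y _; [rewrite lee_fin|exact: gnd].
congr (limn _); apply/funext => n.
transitivity (\int[mu]_x (\sum_(r \in range (g n))
    (r * (h x * \1_(g n @^-1` [set r]) (X x)))%:E)).
  apply: eq_integral => x _.
  rewrite [in LHS](fimfunE (g n)) -fsumEFin// ge0_mule_fsumr//; last first.
    by move=> r; exact: nnfun_muleindic_ge0.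
  by apply: eq_fsbigr => r _; rewrite -EFinM mulrCA.
have mind r : measurable_fun setT
    (fun x => (h x * \1_(g n @^-1` [set r]) (X x))%R).
  apply: measurable_funM => //.
  by apply: (measurableT_comp _ mX); exact: measurable_indic.
rewrite ge0_integral_fsum//; last 2 first.
- by move=> r; apply/measurable_EFinP; exact: measurable_funM.
- move=> r x _; rewrite mulrCA EFinM mule_ge0 ?lee_fin//.
  by have := nnfun_muleindic_ge0 (g n) r (X x); rewrite lee_fin.
rewrite integralT_nnsfun sintegralE ge0_mule_fsumr; last first.
  by move=> r; exact: nnsfun_mulemu_ge0.
apply: eq_fsbigr => r; rewrite inE => -[y _ <-].
under eq_integral do rewrite EFinM.
rewrite ge0_integralZl_EFin//; last 2 first.
- by move=> x _; rewrite lee_fin mulr_ge0.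
- exact/measurable_EFinP.
rewrite muleCA -hX//; congr (_ * _).
rewrite [RHS]integral_mkcond; apply: eq_integral => x _.
rewrite patchE indicE; case: ifPn => xg.
  by rewrite mem_set ?mulr1//; move: xg; rewrite inE.
by rewrite memNset ?mulr0//; move: xg; rewrite notin_setE.
Qed.

End weighted_integral.

Section independent_product.
Local Open Scope ereal_scope.
Context d d' (T : measurableType d) (E : measurableType d') (R : realType).
Variables (P : probability T R) (I : finType) (X : I -> T -> E).
Hypothesis indX : mutually_independent P X.

(* Starting from indicators, where it is the product rule, the [f i] are replaced
   by general functions one index at a time. *)
Lemma integral_prod_independent (f : I -> E -> R) (e : I -> R) :
  (forall i, measurable_fun setT (f i)) -> (forall i y, (0 <= f i y)%R) ->
  (forall i, \int[P]_x (f i (X i x))%:E = (e i)%:E) ->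
  \int[P]_x (\prod_i f i (X i x))%:E = (\prod_i e i)%:E.
Proof.
have [mX PX] := indX.
suff main (s : seq I) : forall (f : I -> E -> R) (e : I -> R),
    (forall i, i \notin s -> exists2 B, measurable B & f i = \1_B) ->
    (forall i, measurable_fun setT (f i)) -> (forall i y, (0 <= f i y)%R) ->
    (forall i, \int[P]_x (f i (X i x))%:E = (e i)%:E) ->
    \int[P]_x (\prod_i f i (X i x))%:E = (\prod_i e i)%:E.
  by move=> mf f0 fe; apply: (main (enum I)) => // i; rewrite mem_enum.
have mXB i B : measurable B -> measurable (X i @^-1` B).
  by move=> mB; rewrite -(setTI (_ @^-1` _)); exact: mX.
have intB i B : measurable B -> \int[P]_x (\1_B (X i x))%:E = P (X i @^-1` B).
  move=> mB; have := integral_indic P measurableT (mXB i B mB).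
  by rewrite setIT => <-.
have PE (A : set T) : measurable A -> (fine (P A))%:E = P A.
  by move=> mA; rewrite fineK// fin_num_measure.
elim: s => [|k s IH] f' e' find mf f0 fe.
  have /choice[B BP] i : exists B, measurable B /\ f' i = \1_B.
    by have [//|B mB fB] := find i; exists B.
  have -> : (fun x => (\prod_i f' i (X i x))%:E) =
      EFin \o \1_(\bigcap_i (X i @^-1` B i)).
    apply/funext => x /=; congr EFin; rewrite indicE.
    case: (asboolP ((\bigcap_i (X i @^-1` B i)) x)) => xB.
      rewrite mem_set// big1// => i _.
      by rewrite (BP i).2 indicE mem_set//; exact: xB.
    rewrite memNset//; apply/eqP/prodf_eq0.
    move/existsNP : xB => [i /not_implyP[_ xBi]]; exists i => //.
    by rewrite (BP i).2 indicE memNset.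
  rewrite integral_indic ?setIT//; last first.
    by apply: fin_bigcap_measurable => [|i _]; [exact: finite_finset|
      apply: mXB; exact: (BP i).1].
  apply: (etrans (PX _ (fun i => (BP i).1))).
  rewrite -prodEFin; apply: eq_bigr => i _.
  by rewrite -fe (BP i).2 intB//; exact: (BP i).1.
have mfX i : measurable_fun setT (fun x => f' i (X i x)).
  exact: (measurableT_comp (mf i) (mX i)).
have e0 i : (0 <= e' i)%R.
  by rewrite -lee_fin -fe; apply: integral_ge0 => x _; rewrite lee_fin.
rewrite [in RHS](bigD1 k)//= mulrC EFinM -fe.
have -> : (fun x => (\prod_i f' i (X i x))%:E) =
    fun x => (\prod_(i | i != k) f' i (X i x))%:E * (f' k (X k x))%:E.
  by apply/funext => x; rewrite (bigD1 k)//= mulrC EFinM.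
(* The other factors act as the density [h]. The required identity on sets is the induction
   hypothesis with [f' k] replaced by an indicator. *)
rewrite (@ge0_integral_weighted _ _ T E R P (pushforward P (X k))
  (fun x => \prod_(i | i != k) f' i (X i x))%R (X k)
  (\prod_(i | i != k) e' i)%R _ _ _ _ (EFin \o f' k))//.
- congr (_ * _); rewrite ge0_integral_pushforward//.
  + exact/measurable_EFinP.
  + by move=> y _; rewrite /= lee_fin.
- under eq_fun do rewrite -big_filter.
  by apply: measurable_prod => i _; exact: mfX.
- by move=> x; apply: prodr_ge0.
- move=> B mB.
  pose g i := if i == k then \1_B else f' i.
  pose c i := if i == k then fine (P (X k @^-1` B)) else e' i.
  have gk : g k = \1_B by rewrite /g eqxx.
  have ck : c k = fine (P (X k @^-1` B)) by rewrite /c eqxx.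
  have gN i : i != k -> g i = f' i by rewrite /g => /negbTE ->.
  have cN i : i != k -> c i = e' i by rewrite /c => /negbTE ->.
  have prodc : (\prod_i c i)%:E =
      (\prod_(i | i != k) e' i)%:E * P (X k @^-1` B).
    rewrite (bigD1 k)//= ck mulrC EFinM PE; last exact: mXB.
    by congr (_%:E * _); apply: eq_bigr => i /cN.
  rewrite -[RHS]prodc -(IH g c).
  + rewrite integral_mkcond; apply: eq_integral => x _.
    rewrite patchE [in RHS](bigD1 k)//= gk indicE.
    rewrite [in RHS](eq_bigr (fun i => f' i (X i x))).
      case: ifPn => xg; first by rewrite mem_set ?mul1r//; move: xg; rewrite inE.
      by rewrite memNset ?mul0r//; move: xg; rewrite notin_setE.
    by move=> i /gN ->.
  + move=> i iS; have [->|ik] := eqVneq i k; first by exists B.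
    by rewrite gN//; apply: find; rewrite inE negb_or ik.
  + move=> i; have [->|ik] := eqVneq i k; last by rewrite gN.
    by rewrite gk; exact: measurable_indic.
  + move=> i y; have [->|ik] := eqVneq i k; last by rewrite gN.
    by rewrite gk.
  + move=> i; have [->|ik] := eqVneq i k; last by rewrite gN// cN.
    by rewrite gk ck intB// PE//; exact: mXB.
- exact/measurable_EFinP.
- by move=> y; rewrite /= lee_fin.
Qed.

End independent_product.

(** * The standard Gaussian measure *)

Section gaussian_plane.
Local Open Scope ereal_scope.
Context {R : realType}.
Local Notation leb := (@lebesgue_measure R).
Local Notation gamma := (normal_prob (0 : R) 1).
Local Notation phi := (normal_pdf (0 : R) 1).

Lemma ge0_integral_gauss (f : R -> \bar R) : measurable_fun setT f ->
  (forall x, 0 <= f x) ->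
  \int[gamma]_x f x = \int[leb]_x ((phi x)%:E * f x).
Proof.
move=> mf f0.
rewrite (@ge0_integral_weighted _ _ _ _ R leb gamma phi id 1%R)//.
- by rewrite mul1e.
- exact: measurable_normal_pdf.
- by move=> x; exact: normal_pdf_ge0.
- by move=> B mB; rewrite mul1e.
Qed.

(** Lebesgue measure is determined by the lengths of half-open intervals, and a shift preserves
    these. *)
Lemma ge0_integral_translation (a : R) (f : R -> \bar R) : measurable_fun setT f ->
  (forall x, 0 <= f x) -> \int[leb]_x f (x + a)%R = \int[leb]_x f x.
Proof.
move=> mf f0.
have ma : measurable_fun [set: measurableTypeR R]
    ((fun x => x + a)%R : measurableTypeR R -> measurableTypeR R).
  exact: measurable_funD.
transitivity (\int[pushforward leb
    ((fun x => x + a)%R : measurableTypeR R -> measurableTypeR R)]_x f x).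
  by rewrite ge0_integral_pushforward.
apply: eq_measure_integral => //= A mA _; apply/esym.
apply: lebesgue_measure_unique => //= _ [[x y]] _ <-.
rewrite /pushforward (_ : _ @^-1` _ = `](x - a)%R, (y - a)%R]%classic); last first.
  by apply/seteqP; split => z /=; rewrite !in_itv/= ltrBlDr lerBrDr.
rewrite !lebesgue_measure_itv/= !lte_fin ltrD2r; case: ifP => // _.
by rewrite -!EFinB; congr EFin; lra.
Qed.

Lemma ge0_integral_shear2 (b : R) (H : R * R -> \bar R) : measurable_fun setT H ->
  (forall p, 0 <= H p) ->
  \int[leb]_x \int[leb]_y H (x, y + b * x)%R = \int[leb]_x \int[leb]_y H (x, y).
Proof.
move=> mH H0; apply: eq_integral => x _.
apply: (@ge0_integral_translation (b * x)%R (fun y => H (x, y))) => //.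
by apply: (measurableT_comp mH); exact: measurable_fun_pair.
Qed.

(** Tonelli makes the sheared variable the inner one; for fixed [y] the shear is then a
    translation. *)
Lemma ge0_integral_shear1 (a : R) (H : R * R -> \bar R) : measurable_fun setT H ->
  (forall p, 0 <= H p) ->
  \int[leb]_x \int[leb]_y H (x + a * y, y)%R = \int[leb]_x \int[leb]_y H (x, y).
Proof.
move=> mH H0.
pose H' (p : R * R) := H (p.1 + a * p.2, p.2)%R.
have mH' : measurable_fun setT H'.
  apply: (measurableT_comp mH); apply: measurable_fun_pair => //=.
  by apply: measurable_funD => //; exact: measurable_funM.
apply: (etrans (@fubini_tonelli _ _ _ _ _ leb leb H' mH' (fun _ => H0 _))).
apply/esym/(etrans (@fubini_tonelli _ _ _ _ _ leb leb H mH H0))/esym.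
apply: eq_integral => y _.
apply: (@ge0_integral_translation (a * y)%R (fun x => H (x, y))) => //.
by apply: (measurableT_comp mH); exact: measurable_fun_pair.
Qed.

(* For [s != 0] the rotation is a product of three shears, each of which is a
   translation in one variable. *)
Lemma ge0_integral_rotation (c s : R) (H : R * R -> \bar R) :
  measurable_fun setT H -> (forall p, 0 <= H p) ->
  s != 0%R -> (c ^+ 2 + s ^+ 2 = 1)%R ->
  \int[leb]_x \int[leb]_y H (c * x - s * y, s * x + c * y)%R =
  \int[leb]_x \int[leb]_y H (x, y).
Proof.
(* The product of the shears with parameters [a], [s], [a] has diagonal entries [1 + a s] and corner
   entries [a (2 + a s)] and [s]. Requiring [1 + a s = c] fixes [a], and [c ^ 2 + s ^ 2 = 1] then
   makes the corner [a (1 + c)] equal to [- s]. *)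
move=> mH H0 s0 cs1; pose a := ((c - 1) / s)%R.
pose H1 (p : R * R) := H (p.1 + a * p.2, p.2)%R.
pose H2 (p : R * R) := H1 (p.1, p.2 + s * p.1)%R.
have mH1 : measurable_fun setT H1.
  apply: (measurableT_comp mH); apply: measurable_fun_pair => //=.
  by apply: measurable_funD => //; exact: measurable_funM.
have mH2 : measurable_fun setT H2.
  apply: (measurableT_comp mH1); apply: measurable_fun_pair => //=.
  by apply: measurable_funD => //; exact: measurable_funM.
have e1' := @ge0_integral_shear1 a H mH H0.
have e2' := @ge0_integral_shear2 s H1 mH1 (fun p => H0 _).
have e3' := @ge0_integral_shear1 a H2 mH2 (fun p => H0 _).
apply: etrans (etrans e3' (etrans e2' e1')).
apply: eq_integral => x _; apply: eq_integral => y _.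
have e1 : (a * s = c - 1)%R by rewrite /a divfK.
have e2 : (a * (1 + c) = - s)%R.
  apply: (mulIf s0); rewrite mulrAC e1 mulNr -expr2.
  have -> : (s ^+ 2 = 1 - c ^+ 2)%R by rewrite -cs1; ring.
  by ring.
rewrite /H2 /H1/=; congr (H (_, _)).
  transitivity (c * x + (a * (1 + c)) * y)%R; first by rewrite e2; ring.
  transitivity (x + 2 * a * y + (a * s) * (x + a * y))%R; last by ring.
  by rewrite e1; ring.
transitivity (s * x + (1 + a * s) * y)%R; last by ring.
by rewrite e1; ring.
Qed.

Lemma gauss_pdf_radial (x y x' y' : R) : (x ^+ 2 + y ^+ 2 = x' ^+ 2 + y' ^+ 2)%R ->
  (phi x * phi y = phi x' * phi y')%R.
Proof.
have phiE (u v : R) : (phi u * phi v =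
    normal_peak 1 * normal_peak 1 * expR (- (u ^+ 2 + v ^+ 2) / 2))%R.
  rewrite !normal_pdfE ?oner_neq0// /normal_fun !subr0 expr1n mulrACA -expRD.
  by rewrite opprD mulrDl.
by move=> e; rewrite (phiE x y) e (phiE x' y').
Qed.

Lemma gauss_plane_rotation (c s : R) (F : R * R -> \bar R) :
  measurable_fun setT F -> (forall p, 0 <= F p) ->
  s != 0%R -> (c ^+ 2 + s ^+ 2 = 1)%R ->
  \int[gamma]_x \int[gamma]_y F (c * x - s * y, s * x + c * y)%R =
  \int[gamma]_x \int[gamma]_y F (x, y).
Proof.
move=> mF F0 s0 cs1.
pose H (p : R * R) := (phi p.1 * phi p.2)%:E * F p.
have mphi : measurable_fun setT phi by exact: measurable_normal_pdf.
have phi0 x : (0 <= phi x)%R by exact: normal_pdf_ge0.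
have gE (G : R * R -> \bar R) : measurable_fun setT G -> (forall p, 0 <= G p) ->
    \int[gamma]_x \int[gamma]_y G (x, y) =
    \int[leb]_x \int[leb]_y ((phi x * phi y)%:E * G (x, y)).
  move=> mG G0; rewrite ge0_integral_gauss//; last 2 first.
  - exact: (@measurable_fun_fubini_tonelli_F _ _ _ _ _ gamma G).
  - by move=> x; apply: integral_ge0.
  have mG2 x : measurable_fun setT (fun y => G (x, y)).
    by apply: (measurableT_comp mG); exact: measurable_fun_pair.
  have mphiG x : measurable_fun setT (fun y : R => (phi y)%:E * G (x, y)).
    by apply: emeasurable_funM => //; exact/measurable_EFinP.
  apply: eq_integral => x _; rewrite ge0_integral_gauss//.
  rewrite -ge0_integralZl//.
  - by apply: eq_integral => y _; rewrite EFinM muleA.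
  - exact: mphiG.
  - by move=> y _; rewrite mule_ge0// lee_fin.
  - by rewrite lee_fin.
have phirot (x y : R) :
    (phi (c * x - s * y) * phi (s * x + c * y) = phi x * phi y)%R.
  apply: gauss_pdf_radial.
  transitivity ((c ^+ 2 + s ^+ 2) * (x ^+ 2 + y ^+ 2))%R; first by ring.
  by rewrite cs1 mul1r.
pose F' (p : R * R) := F (c * p.1 - s * p.2, s * p.1 + c * p.2)%R.
have mF' : measurable_fun setT F'.
  apply: (measurableT_comp mF); apply: measurable_fun_pair => /=.
    by apply: measurable_funB; exact: measurable_funM.
  by apply: measurable_funD; exact: measurable_funM.
have mH : measurable_fun setT H.
  apply: emeasurable_funM => //; apply/measurable_EFinP.
  by apply: measurable_funM; exact: measurableT_comp.
have H0 p : 0 <= H p by rewrite mule_ge0// lee_fin mulr_ge0.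
apply: (etrans (gE F' mF' (fun p => F0 _))).
apply/esym/(etrans (gE F mF F0))/esym.
apply: etrans (ge0_integral_rotation mH H0 s0 cs1).
apply: eq_integral => x _; apply: eq_integral => y _; rewrite /H/=.
by congr (_%:E * _); exact/esym/phirot.
Qed.

End gaussian_plane.

(** The difference of the two sides is half a square. At [t = sqrt (1 - 2 k)] the right-hand side is
    [k / (1 - 2 k)], which removes the square root from the exponential moment. *)
Lemma invr_sub1_le (R : realFieldType) (t : R) : 0 < t ->
  t^-1 - 1 <= (1 - t ^+ 2) / 2 / t ^+ 2.
Proof.
move=> t0; rewrite -subr_ge0.
have -> : (1 - t ^+ 2) / 2 / t ^+ 2 - (t^-1 - 1) = ((1 - t) / t) ^+ 2 / 2.
  by field; rewrite gt_eqF.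
by rewrite divr_ge0// sqr_ge0.
Qed.

(** * Moments of the standard normal law *)

Section gaussian_moments.
Local Open Scope ereal_scope.
Context {R : realType}.
Local Notation leb := (@lebesgue_measure R).
Local Notation gamma := (normal_prob (0 : R) 1).
Local Notation phi := (normal_pdf (0 : R) 1).

Lemma integral_gauss_cst (r : \bar R) : \int[gamma]_x r = r.
Proof.
by rewrite integral_cst//= [X in _ * X](@probability_setT _ _ _ gamma) mule1.
Qed.

(** A quarter turn of the plane, applied to a function of the first coordinate, produces [- y] in
    that coordinate. *)
Lemma ge0_integral_gauss_reflection (f : R -> \bar R) : measurable_fun setT f ->
  (forall x, 0 <= f x) -> \int[gamma]_x f (- x)%R = \int[gamma]_x f x.
Proof.
move=> mf f0; pose F (p : R * R) := f p.1.
have mF : measurable_fun setT F by exact: (measurableT_comp mf).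
have := @gauss_plane_rotation R 0 1 F mF (fun p => f0 _) (oner_neq0 _).
rewrite expr0n expr1n add0r /F/= => /(_ erefl).
under [X in _ = X -> _]eq_integral => x _.
  rewrite integral_gauss_cst; over.
move=> <-; under [in RHS]eq_integral => x _.
  under eq_integral => y _ do rewrite mul0r mul1r sub0r.
  over.
by rewrite integral_gauss_cst.
Qed.

(** The tilted density is [s] times the normal density of standard deviation
    [s = (1 - 2 k) ^ (-1/2)], which has integral 1. *)
Lemma integral_gauss_expR_sqr (k : R) : (k < 2^-1)%R ->
  \int[gamma]_x (expR (k * x ^+ 2))%:E = ((Num.sqrt (1 - 2 * k))^-1)%:E.
Proof.
move=> k2; have k1 : (0 < 1 - 2 * k)%R by lra.
pose s := ((Num.sqrt (1 - 2 * k))^-1)%R.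
have s0 : (0 < s)%R by rewrite invr_gt0 sqrtr_gt0.
have s2 : (s ^+ 2 = (1 - 2 * k)^-1)%R by rewrite exprVn sqr_sqrtr// ltW.
have me : measurable_fun [set: R] (fun x => (expR (k * x ^+ 2))%:E).
  apply/measurable_EFinP/measurableT_comp => //.
  by apply: measurable_funM => //; exact: measurable_funX.
rewrite ge0_integral_gauss//.
have pdfE (x : R) : (phi x * expR (k * x ^+ 2) = s * normal_pdf 0 s x)%R.
  rewrite !normal_pdfE ?oner_neq0 ?gt_eqF// /normal_fun !subr0 expr1n.
  rewrite -mulrA -expRD mulrA; congr (_ * expR _)%R.
    rewrite /normal_peak expr1n mul1r -mulrnAr sqrtrM ?sqr_ge0// sqrtr_sqr.
    rewrite gtr0_norm// invfM mulrA mulfV ?mul1r// gt_eqF//.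
  rewrite -mulr_natr s2; field; lra.
transitivity (\int[leb]_x (s%:E * (normal_pdf 0 s x)%:E)).
  by apply: eq_integral => x _; rewrite -!EFinM; congr EFin; exact: pdfE.
rewrite ge0_integralZl_EFin//.
- by rewrite integral_normal_pdf mule1.
- by move=> x _; rewrite lee_fin normal_pdf_ge0.
- by apply/measurable_EFinP; exact: measurable_normal_pdf.
- exact: ltW.
Qed.

(* [1 + z <= expR z] at [z = k x ^ 2] and [z = - k x ^ 2] squeezes the second
   moment between the exponential moments as [k] tends to 0. *)
Lemma integral_gauss_sqr : \int[gamma]_x (x ^+ 2)%:E = 1.
Proof.
have mX : measurable_fun [set: R] (fun x : R => (x ^+ 2)%:E).
  by apply/measurable_EFinP; exact: measurable_funX.
have me (k : R) : measurable_fun [set: R] (fun x => (expR (k * x ^+ 2))%:E).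
  apply/measurable_EFinP/measurableT_comp => //.
  by apply: measurable_funM => //; exact: measurable_funX.
have int1 : \int[gamma]_x 1 = 1 by rewrite integral_gauss_cst.
have M0 : 0 <= \int[gamma]_x (x ^+ 2)%:E.
  by apply: integral_ge0 => x _; rewrite lee_fin sqr_ge0.
have upper (k : R) : (0 < k)%R -> (k < 2^-1)%R ->
    k%:E * \int[gamma]_x (x ^+ 2)%:E <= (k / (1 - 2 * k))%:E.
  move=> k0 k2.
  have : 1 + k%:E * \int[gamma]_x (x ^+ 2)%:E <= ((Num.sqrt (1 - 2 * k))^-1)%:E.
    rewrite -integral_gauss_expR_sqr// -ge0_integralZl_EFin ?(ltW k0)//; last first.
      by move=> x _; rewrite lee_fin sqr_ge0.
    rewrite -[X in X + _]int1 -ge0_integralD//; last 2 first.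
    - by move=> x _; rewrite -EFinM lee_fin mulr_ge0 ?sqr_ge0// ltW.
    - exact: measurable_funeM.
    apply: ge0_le_integral => //.
    - by move=> x _; rewrite -EFinM lee_fin addr_ge0// mulr_ge0 ?sqr_ge0// ltW.
    - apply: emeasurable_funD => //; exact: measurable_funeM.
    - exact: me.
    - by move=> x _; rewrite -EFinM lee_fin expR_ge1Dx.
  have k1 : (0 < 1 - 2 * k)%R by lra.
  have := sqr_sqrtr (ltW k1); have := k1; rewrite -sqrtr_gt0.
  move: (Num.sqrt _) => t t0 tE.
  case: (\int[gamma]_x (x ^+ 2)%:E) M0 => [M| |]//=; last first.
    by rewrite gt0_muley// lte_fin.
  move=> _; rewrite -!EFinM -EFinD !lee_fin -tE => tM.
  have : (k * M <= t^-1 - 1)%R by lra.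
  move/le_trans; apply.
  by have := invr_sub1_le t0; rewrite tE; congr (_ <= _ / _)%R; lra.
have lower (k : R) : (0 < k)%R -> (k < 2^-1)%R ->
    (k / (1 + 2 * k))%:E <= k%:E * \int[gamma]_x (x ^+ 2)%:E.
  move=> k0 k2.
  have : 1 <= ((Num.sqrt (1 - 2 * (- k)))^-1)%:E + k%:E * \int[gamma]_x (x ^+ 2)%:E.
    rewrite -integral_gauss_expR_sqr//; last by lra.
    rewrite -ge0_integralZl_EFin ?(ltW k0)//; last first.
      by move=> x _; rewrite lee_fin sqr_ge0.
    rewrite -[X in X <= _]int1 -ge0_integralD//; last 3 first.
    - exact: me.
    - by move=> x _; rewrite -EFinM lee_fin mulr_ge0 ?sqr_ge0// ltW.
    - exact: measurable_funeM.
    apply: ge0_le_integral => //.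
    - by apply: emeasurable_funD; [exact: me|exact: measurable_funeM].
    - move=> x _; rewrite -EFinM lee_fin.
      by have := expR_ge1Dx (- k * x ^+ 2); lra.
  have k1 : (0 < 1 - 2 * - k)%R by lra.
  have := sqr_sqrtr (ltW k1); have := k1; rewrite -sqrtr_gt0.
  move: (Num.sqrt _) => t t0 tE.
  case: (\int[gamma]_x (x ^+ 2)%:E) M0 => [M| |]//=; last first.
    by move=> _ _; rewrite gt0_muley ?leey// lte_fin.
  move=> _; rewrite -!EFinM -EFinD !lee_fin => tM.
  have := invr_sub1_le t0; rewrite tE.
  have -> : ((1 - (1 - 2 * - k)) / 2 = - k)%R by lra.
  rewrite mulNr mulrN opprK; move: (k / (1 + 2 * k))%R => r; lra.
case: (\int[gamma]_x (x ^+ 2)%:E) M0 lower upper => [M| |]//=; last first.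
  move=> _ _ /(_ 4^-1%R); rewrite gt0_muley ?lte_fin ?invr_gt0//.
  by move=> H; have : +oo <= (4^-1 / (1 - 2 / 4))%:E :> \bar R by apply: H; lra.
rewrite lee_fin => M0 lower upper; congr EFin; apply/eqP; rewrite eq_le.
(* The upper estimate reads [M (1 - 2 k) <= 1]: with [k <= 1/4] it gives [M <= 2], hence
   [M <= 1 + 4 k <= 1 + e]. The lower one reads [1 <= M (1 + 2 k)], which suffices when [M <= 1]. *)
apply/andP; split; apply/ler_addgt0Pr => e e0; pose k := Num.min (e / 4)%R (4^-1)%R.
- have k0 : (0 < k)%R by rewrite lt_min; apply/andP; split; lra.
  have [ke k4] : (k <= e / 4 /\ k <= 4^-1)%R by rewrite !ge_min !lexx orbT.
  have /upper : (k < 2^-1)%R by lra.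
  rewrite -EFinM lee_fin => /(_ k0); rewrite ler_pdivlMr; last by lra.
  rewrite -mulrA ger_pMr// => kM.
  have M2 : (M <= 2)%R by nra.
  by nra.
- have k0 : (0 < k)%R by rewrite lt_min; apply/andP; split; lra.
  have [ke k4] : (k <= e / 4 /\ k <= 4^-1)%R by rewrite !ge_min !lexx orbT.
  have /lower : (k < 2^-1)%R by lra.
  rewrite -EFinM lee_fin => /(_ k0); rewrite ler_pdivrMr; last by lra.
  rewrite -mulrA ler_pMr// => kM.
  by have [M1|M1] := leP M 1%R; nra.
Qed.

(** By reflection the integral is unchanged under [q] to [- q]. Adding both versions cancels the
    cross term pointwise, so no signed integral appears. *)
Lemma integral_gauss_affine_sqr (p q : R) :
  \int[gamma]_x ((p + q * x) ^+ 2)%:E = (p ^+ 2 + q ^+ 2)%:E.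
Proof.
have mA (r : R) : measurable_fun [set: R] (fun x : R => ((p + r * x) ^+ 2)%:E).
  apply/measurable_EFinP; apply: measurable_funX; apply: measurable_funD => //.
have refl : \int[gamma]_x ((p - q * x) ^+ 2)%:E = \int[gamma]_x ((p + q * x) ^+ 2)%:E.
  rewrite -(@ge0_integral_gauss_reflection (fun x => ((p + q * x) ^+ 2)%:E))//.
    by apply: eq_integral => x _; rewrite mulrN.
  by move=> x; rewrite lee_fin sqr_ge0.
have : \int[gamma]_x ((p + q * x) ^+ 2)%:E + \int[gamma]_x ((p + q * x) ^+ 2)%:E
    = (2 * p ^+ 2 + 2 * q ^+ 2)%:E.
  rewrite -[X in _ + X]refl.
  have mB : measurable_fun [set: R] (fun x : R => ((p - q * x) ^+ 2)%:E).
    by have := mA (- q)%R; apply: eq_measurable_fun => x _; rewrite mulNr.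
  have mX : measurable_fun [set: R] (fun x : R => (x ^+ 2)%:E).
    by apply/measurable_EFinP; exact: measurable_funX.
  rewrite -ge0_integralD//; last 3 first.
  - by move=> x _; rewrite lee_fin sqr_ge0.
  - exact: mA.
  - by move=> x _; rewrite lee_fin sqr_ge0.
  transitivity (\int[gamma]_x ((2 * p ^+ 2)%:E + (2 * q ^+ 2)%:E * (x ^+ 2)%:E)).
    by apply: eq_integral => x _; rewrite -EFinM -!EFinD; congr EFin; ring.
  rewrite ge0_integralD//.
  - rewrite integral_gauss_cst ge0_integralZl_EFin//.
    -   by rewrite integral_gauss_sqr mule1.
    - by move=> x _; rewrite lee_fin sqr_ge0.
    - by rewrite mulr_ge0// sqr_ge0.
  - by move=> x _; rewrite lee_fin mulr_ge0// sqr_ge0.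
  - by move=> x _; rewrite -EFinM lee_fin mulr_ge0 ?sqr_ge0// mulr_ge0 ?sqr_ge0.
  - exact: measurable_funeM.
case: (\int[gamma]_x ((p + q * x) ^+ 2)%:E) => [M| |]//=.
by rewrite -EFinD => -[] e; congr EFin; lra.
Qed.

End gaussian_moments.

(** * Rotation invariance of families of independent standard normal variables *)

Definition normal_family d (T : measurableType d) (R : realType)
    (P : probability T R) (J : finType) (X : J -> T -> R) :=
  (forall i, measurable_fun setT (X i)) /\
  forall B : J -> set R, (forall i, measurable (B i)) ->
    P (\bigcap_i (X i @^-1` B i)) = (\prod_i normal_prob (0 : R) 1 (B i))%E.

Lemma normal_family_gaussian_vector d (T : measurableType d) (R : realType)
    (P : probability T R) n (X : T -> n.-tuple R) :
  standard_gaussian_vector P X -> normal_family P (fun j w => tnth (X w) j).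
Proof.
move=> [[mX indX] XB]; split => // B mB; rewrite indX//.
by apply: eq_bigr => j _; exact: XB.
Qed.

Section givens.
Context {R : realType} {J : finType}.
Implicit Types (u v : J -> R) (i k : J).

Definition dot u v := \sum_j u j * v j.

Definition givens i k (c s : R) u j :=
  if j == i then c * u i - s * u k
  else if j == k then s * u i + c * u k else u j.

Lemma dot_givens i k (c s : R) u v : i != k -> c ^+ 2 + s ^+ 2 = 1 ->
  dot (givens i k c s u) (givens i k c s v) = dot u v.
Proof.
move=> ik cs1; have ki : k != i by rewrite eq_sym.
rewrite /dot [LHS](bigD1 i)//= [in LHS](bigD1 k)//=.
rewrite [RHS](bigD1 i)//= [in RHS](bigD1 k)//= !addrA.
congr (_ + _); last first.
  by apply: eq_bigr => j /andP[/negbTE ji /negbTE jk]; rewrite /givens ji jk.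
rewrite /givens eqxx (negbTE ki) eqxx -[RHS]mul1r -cs1; ring.
Qed.

End givens.

Section givens_rotation.
Local Open Scope ereal_scope.
Context d (T : measurableType d) (R : realType) (P : probability T R).
Variables (J : finType) (X : J -> T -> R).
Hypothesis nX : normal_family P X.
Local Notation gamma := (normal_prob (0 : R) 1).

Lemma normal_family_measurable i B : measurable B -> measurable (X i @^-1` B).
Proof. by move=> mB; rewrite -(setTI (_ @^-1` _)); exact: nX.1. Qed.

(** The preimage of a rectangle under a rotation is not a rectangle, so the product rule has to be
    extended to arbitrary measurable sets in two of the coordinates, jointly with product events in
    the others. *)
Lemma normal_family_pair (i k : J) (B : J -> set R) (S : set (R * R)) :
  i != k -> (forall j, measurable (B j)) -> measurable S ->
  P ((fun w => (X i w, X k w)) @^-1` S `&`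
     \bigcap_(j in [set j | (j != i) && (j != k)]) (X j @^-1` B j)) =
  (\prod_(j | (j != i) && (j != k)) gamma (B j)) * (gamma \x gamma) S.
Proof.
move=> ik mB mS.
set W := \bigcap_(j in _) _; set pr := (fun w => _).
have mW : measurable W.
  apply: fin_bigcap_measurable => [|j _]; first exact: finite_finset.
  exact: normal_family_measurable.
have mpr : measurable_fun setT pr by apply: measurable_fun_pair; exact: nX.1.
pose c := fine (\prod_(j | (j != i) && (j != k)) gamma (B j)).
have cE : \prod_(j | (j != i) && (j != k)) gamma (B j) = c%:E.
  rewrite fineK//; apply: (big_ind (fun x => x \is a fin_num)) => //.
  - by move=> x y; exact: fin_numM.
  - by move=> j _; have gfin := fin_num_measure gamma; exact: gfin (mB j).
have c0 : (0 <= c)%R.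
  by rewrite -lee_fin -cE; apply: prode_ge0.
(* Restricting [P] to [W] leaves total mass [c]. Absorbing this constant into one factor brings the
   restricted law under the uniqueness theorem for product measures. *)
pose m1 := mscale (NngNum c0) gamma.
have [m' m'E] : exists m' : {measure set (measurableTypeR R * measurableTypeR R)
    -> \bar R}, forall A, m' A = P (pr @^-1` A `&` W).
  unshelve eexists (pushforward (mrestr P mW)
    (pr : T -> measurableTypeR R * measurableTypeR R)); first exact: mpr.
  by [].
have mE A A' : measurable A -> measurable A' -> m' (A `*` A') = m1 A * gamma A'.
  move=> mA mA'.
  pose D j := if j == i then A else if j == k then A' else B j.
  have mD j : measurable (D j).
    rewrite /D; case: ifP => // _; case: ifP => // _; exact: mB.
  transitivity (P (\bigcap_j (X j @^-1` D j))).
    rewrite m'E; congr (P _); apply/seteqP; split => [w /= [[Aw Aw'] Ww] j _|w Dw].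
      rewrite /D/=; case: eqVneq => [->//|ji]; case: eqVneq => [->//|jk].
      by apply: Ww; rewrite /= ji jk.
    split; first split.
    - by have := Dw i I; rewrite /D /= eqxx.
    - by have := Dw k I; rewrite /D /= eqxx eq_sym (negbTE ik).
    - move=> j /= /andP[ji jk].
      by have := Dw j I; rewrite /D /= (negbTE ji) (negbTE jk).
  rewrite (nX.2 D mD) (bigD1 i)//= (bigD1 k)/=; last by rewrite eq_sym.
  rewrite /m1 /mscale/= -cE {1 2}/D eqxx eq_sym (negbTE ik) eqxx.
  rewrite [X in _ * (_ * X)](eq_bigr (fun j => gamma (B j))); last first.
    by move=> j /andP[ji jk]; rewrite /D (negbTE ji) (negbTE jk).
  by rewrite muleA muleC muleA.
have := @product_measure_unique _ _ _ _ _ m1 gamma m' mE S mS.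
rewrite m'E => <-; rewrite cE /=.
rewrite /product_measure1 ge0_integral_mscale//; exact: measurable_fun_xsection.
Qed.

Lemma normal_family_prob i B : measurable B -> P (X i @^-1` B) = gamma B.
Proof.
move=> mB; pose D j := if j == i then B else setT.
transitivity (P (\bigcap_j (X j @^-1` D j))).
  congr (P _); apply/seteqP; split => [w Bw j _|w /(_ i I)].
    by rewrite /D/=; case: eqVneq => [->|].
  by rewrite /D eqxx.
rewrite (nX.2 D); last by move=> j; rewrite /D; case: ifP.
rewrite (bigD1 i)//= big1 ?mule1 /D ?eqxx// => j /negbTE ->.
exact: (@probability_setT _ _ _ gamma).
Qed.

(** Only the coordinates [i] and [k] change. Their joint law is invariant under the plane rotation,
    and [normal_family_pair] keeps the other coordinates independent of them. *)
Lemma normal_family_givens (i k : J) (c s : R) : i != k -> s != 0%R ->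
  (c ^+ 2 + s ^+ 2 = 1)%R -> normal_family P (fun j w => givens i k c s (X^~ w) j).
Proof.
move=> ik s0 cs1; split => [j|B mB].
  rewrite /givens; case: eqVneq => [_|_].
    apply: measurable_funB; apply: measurable_funM => //; exact: nX.1.
  case: eqVneq => [_|_]; last exact: nX.1.
  by apply: measurable_funD; apply: measurable_funM => //; exact: nX.1.
pose rot (p : R * R) := (c * p.1 - s * p.2, s * p.1 + c * p.2)%R.
have mrot : measurable_fun setT rot.
  apply: measurable_fun_pair => /=.
    by apply: measurable_funB; exact: measurable_funM.
  by apply: measurable_funD; exact: measurable_funM.
have mBB : measurable (B i `*` B k) by exact: measurableX.
have mS : measurable (rot @^-1` (B i `*` B k)).
  by rewrite -(setTI (_ @^-1` _)); exact: mrot.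
transitivity (P ((fun w => (X i w, X k w)) @^-1` (rot @^-1` (B i `*` B k)) `&`
     \bigcap_(j in [set j | (j != i) && (j != k)]) (X j @^-1` B j))).
  congr (P _); apply/seteqP; split => [w Bw|w /= [[Bi Bk] Bj] j _].
    split; last first.
      move=> j /andP[ji jk]; have := Bw j I.
      by rewrite /= /givens (negbTE ji) (negbTE jk).
    split => /=.
      by have := Bw i I; rewrite /= /givens eqxx.
    by have := Bw k I; rewrite /= /givens eqxx eq_sym (negbTE ik).
  rewrite /= /givens; case: eqVneq => [->//|ji]; case: eqVneq => [->//|jk].
  by apply: Bj; rewrite /= ji jk.
rewrite normal_family_pair// [RHS](bigD1 i)//= [in RHS](bigD1 k)/=; last first.
  by rewrite eq_sym.
rewrite muleC muleA; congr (_ * _).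
pose F (p : R * R) : \bar R := (\1_(B i `*` B k) p)%:E.
have mF : measurable_fun setT F by apply/measurable_EFinP; exact: measurable_indic.
have F0 p : 0 <= F p by rewrite lee_fin.
have mG : measurable_fun setT (F \o rot) by exact: measurableT_comp.
transitivity (\int[gamma \x gamma]_p (F (rot p))).
  by have := integral_indic (gamma \x gamma) measurableT mS; rewrite setIT => <-.
apply: (etrans (@fubini_tonelli1 _ _ _ _ _ gamma gamma (F \o rot) mG (fun p => F0 _))).
apply: (etrans (gauss_plane_rotation mF F0 s0 cs1)).
apply: (etrans (esym (@fubini_tonelli1 _ _ _ _ _ gamma gamma F mF F0))).
have := integral_indic (gamma \x gamma) measurableT mBB; rewrite setIT => ->.
by apply: (@product_measure1E _ _ _ _ _ gamma gamma); exact: mB.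
Qed.

End givens_rotation.

(* Each Givens rotation annihilates one nonzero coordinate of [u] and mixes only
   coordinates in the support of [u]; by the last clause a second vector can then
   be rotated without disturbing the first. *)
Lemma rotate_to_axis d (T : measurableType d) (R : realType) (P : probability T R)
    (J : finType) (u : J -> R) : (exists j, u j != 0) ->
  exists O : (J -> R) -> J -> R, [/\
    forall X : J -> T -> R, normal_family P X ->
      normal_family P (fun j w => O (X^~ w) j),
    forall x y, dot (O x) (O y) = dot x y,
    exists2 i, u i != 0 & forall j, j != i -> O u j = 0 &
    forall v j, u j = 0 -> O v j = v j].
Proof.
have [N] := ubnP #|[pred j | u j != 0]|; elim: N u => // N IH u uN [i ui].
have [/existsP[k /andP[ki uk]]|/existsPn noti] :=
    boolP [exists k, (k != i) && (u k != 0)]; last first.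
  exists id; split => //; exists i => // j ji; apply/eqP.
  by have := noti j; rewrite ji/= negbK.
pose rho := Num.sqrt (u i ^+ 2 + u k ^+ 2).
have rho2 : rho ^+ 2 = u i ^+ 2 + u k ^+ 2.
  by rewrite sqr_sqrtr// addr_ge0// sqr_ge0.
have rho0 : rho != 0.
  rewrite sqrtr_eq0 -ltNge ltr_wpDr ?sqr_ge0// lt_neqAle sqr_ge0 andbT eq_sym.
  by rewrite sqrf_eq0.
(* The signs send [(u i, u k)] to [(rho, 0)], so the support loses [k] and keeps [i]; the induction
   is on the size of the support. *)
pose c := u i / rho; pose s := - (u k / rho).
have cs1 : c ^+ 2 + s ^+ 2 = 1.
  by rewrite sqrrN !expr_div_n -mulrDl -rho2 mulfV// sqrf_eq0.
have s0 : s != 0 by rewrite oppr_eq0 mulf_neq0// invr_eq0.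
have ik : i != k by rewrite eq_sym.
pose G := givens i k c s.
have Gi : G u i = rho.
  rewrite /G /givens eqxx /c /s mulNr opprK mulrAC -expr2 [X in _ + X]mulrAC.
  by rewrite -expr2 -mulrDl -rho2 expr2 mulfK.
have Gk : G u k = 0.
  by rewrite /G /givens (negbTE ki) eqxx /c /s; ring.
have GE v j : j != i -> j != k -> G v j = v j.
  by rewrite /G /givens => /negbTE -> /negbTE ->.
have Gsub j : G u j != 0 -> u j != 0 /\ j != k.
  have [->|ji] := eqVneq j i; first by rewrite ui ik.
  by have [->|jk] := eqVneq j k; [rewrite Gk eqxx|rewrite GE].
have [||O [nO dO [i1 ui1 O1] Of]] := IH (G u).
- rewrite -ltnS; apply: leq_trans uN; rewrite ltnS; apply: proper_card.
  apply/properP; split; first by apply/fintype.subsetP => j; rewrite !inE => /Gsub[].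
  by exists k; rewrite !inE ?Gk ?eqxx.
- by exists i; rewrite Gi.
exists (O \o G); split.
- by move=> X nX; apply: (nO (fun j w => G (X^~ w) j)); exact: normal_family_givens.
- by move=> x y; rewrite /= dO dot_givens.
- by exists i1 => //; have [] := Gsub _ ui1.
- move=> v j uj0 /=; have ji : j != i by apply: contra_eq_neq uj0 => ->.
  have jk : j != k by apply: contra_eq_neq uj0 => ->.
  by rewrite Of GE.
Qed.

(** * The joint law of two orthogonal linear forms *)

Section gaussian_law.
Local Open Scope ereal_scope.
Context d (T : measurableType d) (R : realType) (P : probability T R).
Context (J : finType).
Implicit Types (X : J -> T -> R).
Local Notation gamma := (normal_prob (0 : R) 1).

Lemma ge0_integral_normal_family1 X i (f : R -> \bar R) : normal_family P X ->
  measurable_fun setT f -> (forall x, 0 <= f x) ->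
  \int[P]_w f (X i w) = \int[gamma]_x f x.
Proof.
move=> nX mf f0; have mX := nX.1 i.
have := @ge0_integral_weighted _ _ T (measurableTypeR R) R P gamma (cst 1%R) (X i) 1%R.
move=> /(_ (@measurable_cst _ _ _ _ _ _) (fun=> ler01) mX) H.
rewrite -[RHS]mul1e -(H _ f mf f0); first by apply: eq_integral => w _; rewrite mul1e.
move=> B mB; rewrite /= integral_cst ?mul1e; last exact: (normal_family_measurable nX).
exact: (normal_family_prob nX).
Qed.

Lemma ge0_integral_normal_family2 X i k (F : R * R -> \bar R) :
  normal_family P X -> i != k ->
  measurable_fun setT F -> (forall x, 0 <= F x) ->
  \int[P]_w F (X i w, X k w) = \int[gamma]_x \int[gamma]_y F (x, y).
Proof.
move=> nX ik mF F0.
have mpr : measurable_fun setT (fun w => (X i w, X k w)).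
  by apply: measurable_fun_pair; exact: nX.1.
have := @ge0_integral_weighted _ _ T (measurableTypeR R * measurableTypeR R)%type R
   P (gamma \x gamma) (cst 1%R) (fun w => (X i w, X k w)) 1%R.
move=> /(_ (@measurable_cst _ _ _ _ _ _) (fun=> ler01) mpr) H.
transitivity (\int[P]_w (1%:E * F (X i w, X k w))).
  by apply: eq_integral => w _; rewrite mul1e.
apply: (etrans (H _ F mF F0)).
  move=> S mS; rewrite /= integral_cst ?mul1e; last first.
    by rewrite -(setTI (_ @^-1` _)); exact: mpr.
  have := @normal_family_pair _ _ _ _ _ _ nX i k (fun=> setT) S ik _ mS.
  rewrite (_ : \bigcap_(j in _) _ = setT) ?setIT; last first.
    by apply/seteqP; split.
  move=> PS; apply: (etrans (PS _)) => //; rewrite big1 ?mul1e// => j _.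
  exact: (@probability_setT _ _ _ gamma).
by rewrite mul1e; exact: (@fubini_tonelli1 _ _ _ _ _ gamma gamma F mF F0).
Qed.

Lemma ge0_integral_gauss_sqr_eq (a b : R) (f : R -> \bar R) : (a ^+ 2 = b ^+ 2)%R ->
  measurable_fun setT f -> (forall x, 0 <= f x) ->
  \int[gamma]_x f (a * x)%R = \int[gamma]_x f (b * x)%R.
Proof.
move=> /eqP; rewrite eqf_sqr => /orP[/eqP->//|/eqP->] mf f0.
rewrite -[RHS]ge0_integral_gauss_reflection//.
  by apply: eq_integral => x _; rewrite mulNr mulrN.
by apply: (measurableT_comp mf); exact: measurable_funM.
Qed.

(** [O] carries [u] to an axis [i], and [O'] carries [O v] to an axis [k] while fixing coordinate
    [i]. The two forms become [a Y_i] and [b Y_k] with [a ^ 2 = 1] and [b ^ 2 = <v, v>]; the unknown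
    signs disappear by the symmetry of the normal law. A zero [v] has no axis to be rotated to and
    is treated apart. *)
Lemma ge0_integral_gauss_pair X (u v : J -> R) (F : R * R -> \bar R) :
  normal_family P X -> dot u u = 1%R -> dot u v = 0%R ->
  measurable_fun setT F -> (forall x, 0 <= F x) ->
  \int[P]_w F (dot u (X^~ w), dot v (X^~ w)) =
  \int[gamma]_x \int[gamma]_y F (x, Num.sqrt (dot v v) * y)%R.
Proof.
move=> nX uu uv mF F0.
have dot0 (x y : J -> R) : (forall j, x j = 0%R) -> dot x y = 0%R.
  by move=> x0; rewrite /dot big1// => j _; rewrite x0 mul0r.
have dotC (x y : J -> R) : dot x y = dot y x.
  by apply: eq_bigr => j _; rewrite mulrC.
have dot_axis (x y : J -> R) i : (forall j, j != i -> x j = 0%R) ->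
    dot x y = (x i * y i)%R.
  move=> xi; rewrite /dot (bigD1 i)//= big1 ?addr0// => j ji.
  by rewrite xi// mul0r.
have exN (x : J -> R) : dot x x != 0%R -> exists j, x j != 0%R.
  apply: contra_neqP => /forallNP H; apply: dot0 => j; apply/eqP.
  by have /negP := H j; rewrite negbK.
have [|O [nO dO [i ui Oi] Of]] := rotate_to_axis P (u := u).
  by apply: exN; rewrite uu oner_neq0.
pose a := O u i; have a2 : (a ^+ 2 = 1 ^+ 2)%R.
  by rewrite expr1n expr2 -uu -dO (dot_axis _ _ _ Oi).
have a0 : a != 0%R by rewrite -sqrf_eq0 a2 expr1n oner_neq0.
have mFx x : measurable_fun setT (fun y => F (x, y)).
  by apply: (measurableT_comp mF); exact: measurable_fun_pair.
pose q := Num.sqrt (dot v v).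
have vv0 : (0 <= dot v v)%R by apply: sumr_ge0 => j _; rewrite -expr2 sqr_ge0.
(* Orthogonality to [O u], which lies on axis [i]. Hence [i] is outside the support of [O v], and
   [O'] leaves it alone. *)
have Ovi : O v i = 0%R.
  by apply: (mulfI a0); rewrite mulr0 -(dot_axis _ (O v) _ Oi) dO.
have [v0|v0] := eqVneq (dot v v) 0%R.
  have vE j : v j = 0%R.
    move/eqP: v0; rewrite /dot psumr_eq0 => [/allP/(_ j)|k _]; last first.
      by rewrite -expr2 sqr_ge0.
    by rewrite mem_index_enum -expr2 sqrf_eq0 => /(_ isT)/eqP.
  transitivity (\int[P]_w F (a * O (X^~ w) i, 0)%R).
    by apply: eq_integral => w _; rewrite (dot0 v)// -dO (dot_axis _ _ _ Oi).
  rewrite v0 sqrtr0.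
  under [in RHS]eq_integral => x _.
    under eq_integral => y _ do rewrite mul0r.
    rewrite integral_gauss_cst; over.
  have mFy : measurable_fun setT (fun x => F (x, 0%R)).
    by apply: (measurableT_comp mF); exact: measurable_fun_pair.
  rewrite (@ge0_integral_normal_family1 (fun j w => O (X^~ w) j) i
    (fun x => F (a * x, 0)%R))//.
  - rewrite (@ge0_integral_gauss_sqr_eq a 1 (fun x => F (x, 0%R)))//.
    by apply: eq_integral => x _; rewrite mul1r.
  - exact: nO.
  - by apply: (measurableT_comp mFy); exact: measurable_funM.
have [|O' [nO' dO' [k vk Ok] Of']] := rotate_to_axis P (u := O v).
  by apply: exN; rewrite dO.
have ki : k != i by apply: contra_neq vk => ->.
pose a' := O' (O u) i; pose b := O' (O v) k.
have a'E : a' = a by rewrite /a' Of'.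
have b2 : (b ^+ 2 = q ^+ 2)%R.
  by rewrite sqr_sqrtr// expr2 -(dot_axis _ (O' (O v)) _ Ok) dO' dO.
(* Coordinate [i] of [O' (O u)] already carries the whole norm 1, so nothing is left for the
   others. *)
have O'u j : j != i -> O' (O u) j = 0%R.
  move=> ji; apply/eqP; rewrite -sqrf_eq0.
  have : dot (O' (O u)) (O' (O u)) = 1%R by rewrite dO' dO uu.
  rewrite /dot (bigD1 i)//= -/a' a'E -expr2 a2 expr1n => /eqP.
  rewrite -subr_eq0 addrAC subrr add0r psumr_eq0 => [/allP/(_ j)|l _]; last first.
    by rewrite -expr2 sqr_ge0.
  by rewrite mem_index_enum ji -expr2 => /(_ isT).
pose Y j w := O' (O (X^~ w)) j.
have nY : normal_family P Y by apply: (nO' (fun j w => O (X^~ w) j)); exact: nO.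
transitivity (\int[P]_w F (a * Y i w, b * Y k w)%R).
  apply: eq_integral => w _; congr (F (_, _)).
  - by rewrite -dO -dO' (dot_axis _ _ _ O'u) -/a' a'E.
  - by rewrite -dO -dO' (dot_axis _ _ _ Ok).
pose F' (p : R * R) := F (a * p.1, b * p.2)%R.
have mF' : measurable_fun setT F'.
  apply: (measurableT_comp mF); apply: measurable_fun_pair => /=.
    exact: measurable_funM.
  exact: measurable_funM.
apply: (etrans (@ge0_integral_normal_family2 Y i k F' nY _ mF' (fun=> F0 _))).
  by rewrite eq_sym.
rewrite /F'/=.
have mG : measurable_fun setT (fun p : R * R => F (p.1, q * p.2)%R).
  apply: (measurableT_comp mF); apply: measurable_fun_pair => //=.
  exact: measurable_funM.
transitivity (\int[gamma]_x \int[gamma]_y F (a * x, q * y)%R).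
  apply: eq_integral => x _.
  exact: (@ge0_integral_gauss_sqr_eq b q (fun y => F ((a * x)%R, y)) b2 (mFx _)
    (fun=> F0 _)).
rewrite (@ge0_integral_gauss_sqr_eq a 1 (fun x => \int[gamma]_y F (x, q * y)%R))//.
- by apply: eq_integral => x _; rewrite mul1r.
- exact: (@measurable_fun_fubini_tonelli_F _ _ _ _ _ gamma _ mG (fun=> F0 _)).
- by move=> x; apply: integral_ge0.
Qed.

End gaussian_law.

(** * Chernoff bound *)

(** The linear term is exact, so a bound on the mean of a variable enters the bound on its
    exponential moment without loss. *)
Lemma expR_le_quadratic (R : realType) (z : R) :
  expR z <= 1 + z + z ^+ 2 * expR `|z|.
Proof.
have [z0|z0] := leP 0 z.
  have h : expR z - 1 <= z * expR z.
    have := expR_ge1Dx (- z); rewrite -(ler_pM2r (expR_gt0 z)) -expRD addNr expR0.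
    by lra.
  have : z * (expR z - 1) <= z * (z * expR z) by exact: ler_wpM2l.
  by rewrite (ger0_norm z0); lra.
have h : expR z * (1 - z) <= 1.
  have := expR_ge1Dx (- z); rewrite -(ler_pM2l (expR_gt0 z)) -expRD addrN expR0.
  by [].
have : 1 <= expR `|z|.
  by apply: le_trans (expR_ge1Dx _); rewrite lerDl.
have : 0 < expR z by exact: expR_gt0.
move: (expR z) (expR `|z|) h => e e' h e0 e1.
(* The product is [1 - z ^ 3], and [z < 0] here. *)
have : (1 + z + z ^+ 2) * (1 - z) >= 1 by nra.
by nra.
Qed.

(** Squaring [y <= expR y] at [y = kappa z / 4]. Only half of the exponent [kappa] is spent; the
    other half is kept for the factor [expR |s z|] of the quadratic remainder. *)
Lemma sqr_le_expR (R : realType) (kappa z : R) : 0 < kappa -> 0 <= z ->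
  z ^+ 2 <= 16 / kappa ^+ 2 * expR (kappa / 2 * z).
Proof.
move=> k0 z0; rewrite mulrAC ler_pdivlMr ?exprn_gt0//.
have h : kappa * z / 4 <= expR (kappa * z / 4).
  by apply: le_trans (expR_ge1Dx _); rewrite lerDr.
have -> : kappa / 2 * z = kappa * z / 4 + kappa * z / 4 by lra.
have h0 : 0 <= kappa * z / 4 by rewrite divr_ge0// mulr_ge0// ltW.
by rewrite expRD; move: (expR _) h => e h; nra.
Qed.

(* The second term makes the quadratic error [s ^+ 2 * (16 * K / kappa ^+ 2)] of the
   exponential moment at most half of the gain [s * eps]. *)
Definition chernoff_tilt (R : realType) (kappa K eps : R) : R :=
  Num.min (kappa / 2) (eps / (32 * K / kappa ^+ 2)).

Lemma chernoff_tilt_gt0 (R : realType) (kappa K eps : R) :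
  0 < kappa -> 0 < K -> 0 < eps -> 0 < chernoff_tilt kappa K eps.
Proof.
move=> k0 K0 e0; rewrite lt_min divr_gt0//= divr_gt0// divr_gt0 ?exprn_gt0//.
by rewrite mulr_gt0.
Qed.

Section chernoff.
Local Open Scope ereal_scope.
Context d d' (T : measurableType d) (E : measurableType d') (R : realType).
Variables (P : probability T R) (m : nat) (X : 'I_m -> T -> E) (Z : E -> R).
Variables (kappa K mu eps : R).
Hypotheses (indX : mutually_independent P X) (mZ : measurable_fun setT Z).
Hypotheses (kappa0 : (0 < kappa)%R) (K0 : (0 < K)%R) (eps0 : (0 < eps)%R).
Hypothesis ZK : forall i, \int[P]_w (expR (kappa * `|Z (X i w)|))%:E <= K%:E.
Hypothesis Zmu : forall i, \int[P]_w (Z (X i w))%:E <= mu%:E.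

Let s := chernoff_tilt kappa K eps.
Let C := (16 * K / kappa ^+ 2)%R.

Let s0 : (0 < s)%R. Proof. exact: chernoff_tilt_gt0. Qed.

(** Second-order expansion of [expR (s Z)]. Since [s <= kappa / 2], the remainder is at most
    [s ^ 2 (16 / kappa ^ 2) expR (kappa |Z|)], whose integral [K] controls; positivity of [s] is
    what lets an upper bound on the mean suffice. *)
Lemma mgf_bound i : \int[P]_w (expR (s * Z (X i w)))%:E <=
  (expR (s * mu + s ^+ 2 * C))%:E.
Proof.
have mZX : measurable_fun setT (fun w => Z (X i w)).
  by apply: (measurableT_comp mZ); exact: indX.1.
have mEn : measurable_fun setT (fun w => expR (kappa * `|Z (X i w)|)).
  by apply: measurableT_comp => //; apply: measurable_funM => //;
     exact: measurableT_comp.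
have intE : P.-integrable setT (fun w => (expR (kappa * `|Z (X i w)|))%:E).
  apply/integrableP; split; first exact/measurable_EFinP.
  under eq_integral do rewrite /= ger0_norm ?expR_ge0//.
  exact: (le_lt_trans (ZK i) (ltry _)).
have intZ : P.-integrable setT (fun w => (Z (X i w))%:E).
  have := integrableZl measurableT kappa^-1%R intE.
  apply: le_integrable => //; first exact/measurable_EFinP.
  move=> w _; rewrite -EFinM/= lee_fin [leRHS]ger0_norm; last first.
    by rewrite mulr_ge0// ?expR_ge0// invr_ge0 ltW.
  rewrite mulrC ler_pdivlMr// mulrC; apply: le_trans (expR_ge1Dx _).
  by rewrite lerDr.
pose c := (s ^+ 2 * (16 / kappa ^+ 2))%R.
have int2 : P.-integrable setT (fun w => s%:E * (Z (X i w))%:E) by exact: integrableZl.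
have int3 : P.-integrable setT (fun w => c%:E * (expR (kappa * `|Z (X i w)|))%:E).
  exact: integrableZl.
have int1 : P.-integrable setT (fun w => 1%:E).
  exact: finite_measure_integrable_cst.
apply: (@le_trans _ _ (\int[P]_w (1%:E + (s%:E * (Z (X i w))%:E +
    c%:E * (expR (kappa * `|Z (X i w)|))%:E)))).
  apply: ge0_le_integral => //.
  - apply/measurable_EFinP/measurableT_comp => //.
    exact: measurable_funM.
  - exact: (measurable_int _ (integrableD _ int1 (integrableD _ int2 int3))).
  move=> w _; rewrite -!EFinM -!EFinD lee_fin addrA.
  apply: le_trans (expR_le_quadratic _) _; rewrite lerD2l.
  rewrite /c exprMn -mulrA -[leRHS]mulrA ler_wpM2l ?sqr_ge0//.
  rewrite -(real_normK (num_real (Z _))).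
  apply: (@le_trans _ _ (16 / kappa ^+ 2 * expR (kappa / 2 * `|Z (X i w)|) *
     expR (kappa / 2 * `|Z (X i w)|))%R).
    apply: ler_pM => //; [exact: sqr_le_expR|].
    rewrite ler_expR normrM (gtr0_norm s0) ler_wpM2r// /s /chernoff_tilt.
    by rewrite ge_min lexx.
  by rewrite -mulrA -expRD -mulrDl -splitr.
rewrite integralD//; last exact: integrableD.
have -> : \int[P]_w 1%:E = 1%:E.
  by rewrite integral_cst//= [X in _ * X](@probability_setT _ _ _ P) mule1.
rewrite integralD// !integralZl//.
apply: (@le_trans _ _ (1 + (s * mu + c * K)%R%:E)).
  rewrite leeD2l// EFinD; apply: leeD; rewrite [leRHS]EFinM; apply: lee_wpmul2l => //.
    by rewrite lee_fin ltW.
  by rewrite lee_fin mulr_ge0 ?sqr_ge0// divr_ge0// sqr_ge0.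
rewrite -EFinD lee_fin; apply: le_trans (expR_ge1Dx _); rewrite lerD2l lerD2l.
by rewrite /c /C; lra.
Qed.

Lemma chernoff_bound :
  measurable [set w | (m%:R * (mu + eps) <= \sum_i Z (X i w))%R] /\
  P [set w | (m%:R * (mu + eps) <= \sum_i Z (X i w))%R] <=
    (expR (- (s * eps / 2 * m%:R)))%:E.
Proof.
have mZX i : measurable_fun setT (fun w => Z (X i w)).
  by apply: (measurableT_comp mZ); exact: indX.1.
have mS : measurable_fun setT (fun w => \sum_i Z (X i w))%R.
  exact: measurable_sum.
set A := [set w | _].
have mA : measurable A.
  rewrite -(setTI A).
  have -> : A = (fun w => \sum_i Z (X i w))%R @^-1` `[(m%:R * (mu + eps))%R, +oo[.
    by apply/seteqP; split => w /=; rewrite in_itv/= andbT.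
  exact: mS.
split => //.
pose f (i : 'I_m) y := expR (s * Z y).
pose e (i : 'I_m) := fine (\int[P]_w (f i (X i w))%:E).
have eE i : \int[P]_w (f i (X i w))%:E = (e i)%:E.
  rewrite fineK// ge0_fin_numE; last first.
    by apply: integral_ge0 => w _; rewrite lee_fin expR_ge0.
  exact: (le_lt_trans (mgf_bound i) (ltry _)).
have mf (i : 'I_m) : measurable_fun setT (f i).
  by apply: measurableT_comp => //; exact: measurable_funM.
have := integral_prod_independent indX mf (fun i y => expR_ge0 _) eE.
have -> : (fun w => (\prod_i f i (X i w))%:E) =
    (fun w => (expR (s * \sum_i Z (X i w)))%:E).
  by apply/funext => w; rewrite mulr_sumr expR_sum.
move=> intE.
have e_le : (\prod_i e i <= expR (m%:R * (s * mu + s ^+ 2 * C)))%R.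
  rewrite expRM_natl -[in leRHS](card_ord m) -prodr_const.
  apply: ler_prod => i _; rewrite -!lee_fin -eE mgf_bound andbT.
  by apply: integral_ge0 => w _; rewrite lee_fin expR_ge0.
have markov : (expR (s * (m%:R * (mu + eps))))%:E * P A <= (\prod_i e i)%:E.
  rewrite -intE -integral_cst//.
  apply: (@le_trans _ _ (\int[P]_(w in A) (expR (s * \sum_i Z (X i w)))%:E)).
    apply: ge0_le_integral => //.
    - by move=> w _; rewrite lee_fin expR_ge0.
    - apply: measurable_funTS; apply/measurable_EFinP/measurableT_comp => //.
      exact: measurable_funM.
    - by move=> w Aw; rewrite lee_fin ler_expR ler_pM2l.
  apply: ge0_subset_integral => //.
  by apply/measurable_EFinP/measurableT_comp => //; exact: measurable_funM.
have PA : P A \is a fin_num by exact: fin_num_measure.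
rewrite -(fineK PA) lee_fin; move: markov.
rewrite -(fineK PA) -EFinM lee_fin mulrC -ler_pdivlMr ?expR_gt0// => H.
apply: (le_trans H); rewrite ler_pdivrMr ?expR_gt0// -expRD.
apply: (le_trans e_le); rewrite ler_expR.
(* The second term of [chernoff_tilt] is [eps / (2 C)]: the quadratic error costs half of the
   margin, and the other half becomes the rate. *)
have sC : (s * C <= eps / 2)%R.
  have -> : (C = (32 * K / kappa ^+ 2) / 2)%R by rewrite /C; lra.
  rewrite mulrA ler_pM2r// -ler_pdivlMr; last first.
    by rewrite divr_gt0 ?exprn_gt0// mulr_gt0.
  by rewrite /s /chernoff_tilt ge_min lexx orbT.
have : (0 <= m%:R * (s * (eps / 2 - s * C)))%R.
  by rewrite mulr_ge0 ?ler0n// mulr_ge0 ?(ltW s0)//; lra.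
by rewrite expr2; lra.
Qed.

End chernoff.

(** * Population moments of the weights *)

Section tanh.
Context {R : realType}.
Implicit Types t : R.

(** With the argument occurring once, monotonicity, the bound 1 and continuity can be read off. *)
Lemma tanhE t : tanh t = 1 - 2 / (expR (2 * t) + 1).
Proof.
have e0 := expR_gt0 t; rewrite /tanh expRN (_ : 2 * t = t + t); last by lra.
rewrite expRD; field.
by rewrite -expr2 !gt_eqF// ?addr_gt0// ?exprn_gt0// ?mulr_gt0.
Qed.

Lemma lt_tanh t t' : t < t' -> tanh t < tanh t'.
Proof.
move=> tt'; rewrite !tanhE ltrD2l ltrN2 ltr_pM2l// ltf_pV2.
- by rewrite ltrD2r ltr_expR ltr_pM2l.
- by rewrite posrE addr_gt0// expR_gt0.
- by rewrite posrE addr_gt0// expR_gt0.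
Qed.

Lemma le_tanh t t' : t <= t' -> tanh t <= tanh t'.
Proof. by rewrite le_eqVlt => /orP[/eqP->//|/lt_tanh/ltW]. Qed.

Lemma tanh0 : tanh (0 : R) = 0.
Proof. by rewrite /tanh oppr0 subrr mul0r. Qed.

Lemma tanh_le1 t : tanh t <= 1.
Proof. by rewrite tanhE gerBl divr_ge0// addr_ge0// expR_ge0. Qed.

Lemma continuous_tanh : continuous (@tanh R).
Proof.
move=> t; rewrite (_ : @tanh R = fun t => 1 - 2 / (expR (2 * t) + 1)); last first.
  by apply/funext => u; rewrite tanhE.
apply: cvgB; first exact: cvg_cst.
apply: cvgM; first exact: cvg_cst.
apply: cvgV; first by rewrite gt_eqF// addr_gt0// expR_gt0.
apply: cvgD; last exact: cvg_cst.
apply: (cvg_comp (fun x => 2 * x) expR); last exact: continuous_expR.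
by apply: cvgM; [exact: cvg_cst|exact: cvg_id].
Qed.

Variables (alpha beta : R).

Definition trunc_tanh t := tanh (t / alpha) * (beta < t)%R%:R.

Hypotheses (alpha0 : 0 < alpha) (beta0 : 0 < beta).

Lemma trunc_tanh_ge0 t : 0 <= trunc_tanh t.
Proof.
rewrite /trunc_tanh; case: ltP => bt; rewrite ?mulr0// mulr1 -tanh0 le_tanh//.
by rewrite divr_ge0 ?ltW// (lt_trans beta0).
Qed.

Lemma trunc_tanh_le1 t : trunc_tanh t <= 1.
Proof.
by rewrite /trunc_tanh; case: ltP => bt; rewrite ?mulr0// mulr1 tanh_le1.
Qed.

Lemma le_trunc_tanh t t' : t <= t' -> trunc_tanh t <= trunc_tanh t'.
Proof.
move=> tt'; have [bt|bt] := ltP beta t; last first.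
  by rewrite {1}/trunc_tanh ltNge bt/= mulr0 trunc_tanh_ge0.
rewrite /trunc_tanh bt (lt_le_trans bt tt') !mulr1 le_tanh//.
by rewrite ler_pM2r// invr_gt0.
Qed.

Lemma measurable_trunc_tanh : measurable_fun setT trunc_tanh.
Proof.
apply: measurable_funM => /=.
  apply: measurableT_comp.
    by apply: continuous_measurable_fun; exact: continuous_tanh.
  exact: measurable_funM.
rewrite (_ : (fun t => _) = \1_(`]beta, +oo[%classic)).
  exact: measurable_indic.
by apply/funext => t; rewrite indicE mem_setE in_itv/= andbT.
Qed.

Lemma trunc_tanh_cvg t : t != beta ->
  trunc_tanh u @[u --> t] --> trunc_tanh t.
Proof.
move=> tb; have [bt|bt] := ltP beta t.
  have -> : trunc_tanh t = tanh (t / alpha) by rewrite /trunc_tanh bt mulr1.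
  have : tanh (u / alpha) @[u --> t] --> tanh (t / alpha).
    apply: (cvg_comp (fun u => u / alpha) (@tanh R)); last exact: continuous_tanh.
    by apply: cvgM; [exact: cvg_id|exact: cvg_cst].
  apply: cvg_trans; apply: near_eq_cvg; near=> u.
  rewrite /trunc_tanh (_ : beta < u) ?mulr1//; near: u.
  exact: lt_nbhsr.
have -> : trunc_tanh t = 0 by rewrite /trunc_tanh ltNge bt mulr0.
have tb' : t < beta by rewrite lt_neqAle tb.
have : (fun=> 0) @ t --> (0 : R) by exact: cvg_cst.
apply: cvg_trans; apply: near_eq_cvg; near=> u.
rewrite /trunc_tanh ltNge (_ : u <= beta) ?mulr0//; near: u.
by near=> u; rewrite ltW//; near: u; exact: lt_nbhsl.
Unshelve. all: by end_near. Qed.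

End tanh.

Lemma ge0_integral_EFinD d (T : measurableType d) (R : realType)
    (mu : {measure set T -> \bar R}) (f g : T -> R) :
  measurable_fun setT f -> measurable_fun setT g ->
  (forall x, 0 <= f x) -> (forall x, 0 <= g x) ->
  (\int[mu]_x (f x + g x)%:E = \int[mu]_x (f x)%:E + \int[mu]_x (g x)%:E)%E.
Proof.
move=> mf mg f0 g0; under eq_integral do rewrite EFinD.
rewrite ge0_integralD//.
- by move=> x _; rewrite lee_fin.
- exact/measurable_EFinP.
- by move=> x _; rewrite lee_fin.
- exact/measurable_EFinP.
Qed.

Lemma ge0_integral_EFinZl d (T : measurableType d) (R : realType)
    (mu : {measure set T -> \bar R}) (k : R) (f : T -> R) :
  0 <= k -> measurable_fun setT f -> (forall x, 0 <= f x) ->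
  (\int[mu]_x (k * f x)%:E = k%:E * \int[mu]_x (f x)%:E)%E.
Proof.
move=> k0 mf f0; under eq_integral do rewrite EFinM.
rewrite ge0_integralZl_EFin//.
- by move=> x _; rewrite lee_fin.
- exact/measurable_EFinP.
Qed.

Lemma sqr_gt_add2 (R : realFieldType) (b : R) : 0 < b ->
  1 < (2 + b) ^+ 2 /\ b < (2 + b) ^+ 2.
Proof. by move=> b0; have b2 := sqr_ge0 b; split; nra. Qed.

Section population.
Local Open Scope ereal_scope.
Context {R : realType}.
Variables (alpha beta : R).
Hypotheses (alpha0 : (0 < alpha)%R) (beta0 : (0 < beta)%R).
Local Notation gamma := (normal_prob (0 : R) 1).
Implicit Types rho x : R.

(** [rho] stands for the sample mean divided by [|x| ^ 2]: the random value [tau] in the method, the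
    constants [1 - t] and [1 + t] in the estimates. *)
Definition weight rho x := trunc_tanh alpha beta (x ^+ 2 / rho).
Definition weight_mean rho := fine (\int[gamma]_x (weight rho x)%:E).
Definition weight_sqr_mean rho := fine (\int[gamma]_x (weight rho x * x ^+ 2)%:E).

Lemma weight_ge0 rho x : (0 <= weight rho x)%R.
Proof. exact: trunc_tanh_ge0. Qed.

Lemma weight_le1 rho x : (weight rho x <= 1)%R.
Proof. exact: trunc_tanh_le1. Qed.

Lemma le_weight rho rho' x : (0 < rho)%R -> (rho <= rho')%R ->
  (weight rho' x <= weight rho x)%R.
Proof.
move=> r0 rr; apply: le_trunc_tanh => //; apply: ler_wpM2l; first exact: sqr_ge0.
by rewrite lef_pV2// posrE (lt_le_trans r0).
Qed.

Lemma measurable_weight rho : measurable_fun setT (weight rho).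
Proof.
apply: measurableT_comp; first exact: measurable_trunc_tanh.
by apply: measurable_funM => //; exact: measurable_funX.
Qed.

Lemma measurable_weight_sqr rho : measurable_fun setT (fun x => weight rho x * x ^+ 2)%R.
Proof.
by apply: measurable_funM; [exact: measurable_weight|exact: measurable_funX].
Qed.

Lemma integral_weight_le1 rho : \int[gamma]_x (weight rho x)%:E <= 1.
Proof.
rewrite -[leRHS](@integral_gauss_cst R); apply: ge0_le_integral => //.
- by move=> x _; rewrite lee_fin weight_ge0.
- apply/measurable_EFinP; exact: measurable_weight.
- by move=> x _; rewrite lee_fin weight_le1.
Qed.

Lemma integral_weight_sqr_le1 rho : \int[gamma]_x (weight rho x * x ^+ 2)%:E <= 1.
Proof.
rewrite -integral_gauss_sqr; apply: ge0_le_integral => //.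
- by move=> x _; rewrite lee_fin mulr_ge0 ?weight_ge0 ?sqr_ge0.
- apply/measurable_EFinP; exact: measurable_weight_sqr.
- by apply/measurable_EFinP; exact: measurable_funX.
- by move=> x _; rewrite lee_fin ler_piMl ?sqr_ge0 ?weight_le1.
Qed.

Lemma weight_meanE rho : \int[gamma]_x (weight rho x)%:E = (weight_mean rho)%:E.
Proof.
rewrite fineK// ge0_fin_numE; last first.
  by apply: integral_ge0 => x _; rewrite lee_fin weight_ge0.
exact: le_lt_trans (integral_weight_le1 rho) (ltry _).
Qed.

Lemma weight_sqr_meanE rho :
  \int[gamma]_x (weight rho x * x ^+ 2)%:E = (weight_sqr_mean rho)%:E.
Proof.
rewrite fineK// ge0_fin_numE; last first.
  by apply: integral_ge0 => x _; rewrite lee_fin mulr_ge0 ?weight_ge0 ?sqr_ge0.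
exact: le_lt_trans (integral_weight_sqr_le1 rho) (ltry _).
Qed.

Lemma weight_sqr_mean_le1 rho : (weight_sqr_mean rho <= 1)%R.
Proof. by rewrite -lee_fin -weight_sqr_meanE integral_weight_sqr_le1. Qed.

Lemma weight_mean_ge0 rho : (0 <= weight_mean rho)%R.
Proof.
rewrite -lee_fin -weight_meanE.
by apply: integral_ge0 => x _; rewrite lee_fin weight_ge0.
Qed.

Lemma le_weight_mean rho rho' : (0 < rho)%R -> (rho <= rho')%R ->
  (weight_mean rho' <= weight_mean rho)%R.
Proof.
move=> r0 rr; rewrite -lee_fin -!weight_meanE; apply: ge0_le_integral => //.
- by move=> x _; rewrite lee_fin weight_ge0.
- by apply/measurable_EFinP; exact: measurable_weight.
- by apply/measurable_EFinP; exact: measurable_weight.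
- by move=> x _; rewrite lee_fin le_weight.
Qed.

Lemma le_weight_sqr_mean rho rho' : (0 < rho)%R -> (rho <= rho')%R ->
  (weight_sqr_mean rho' <= weight_sqr_mean rho)%R.
Proof.
move=> r0 rr; rewrite -lee_fin -!weight_sqr_meanE; apply: ge0_le_integral => //.
- by move=> x _; rewrite lee_fin mulr_ge0 ?weight_ge0 ?sqr_ge0.
- by apply/measurable_EFinP; exact: measurable_weight_sqr.
- by apply/measurable_EFinP; exact: measurable_weight_sqr.
- by move=> x _; rewrite lee_fin ler_wpM2r ?sqr_ge0// le_weight.
Qed.

(** On this interval the density is at least its value at the right end. *)
Lemma gauss_itv_gt0 (M : R) : (0 <= M)%R -> 0 < gamma `[M, (M + 1)%R]%classic.
Proof.
move=> M0.
pose c := normal_pdf (0 : R) 1 (M + 1).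
have c0 : (0 < c)%R.
  rewrite /c normal_pdfE ?oner_neq0// mulr_gt0 ?expR_gt0//.
  by rewrite normal_peak_gt0// oner_neq0.
apply: (@lt_le_trans _ _ (\int[lebesgue_measure]_(x in `[M, (M + 1)%R]) c%:E)).
  rewrite integral_cst//= lebesgue_measure_itv/= lte_fin ltrDl ltr01.
  by rewrite -EFinD addrAC subrr add0r mule1 lte_fin.
apply: ge0_le_integral => //.
- by move=> x _; rewrite lee_fin ltW.
- apply: measurable_funTS; apply/measurable_EFinP; exact: measurable_normal_pdf.
- move=> x /=; rewrite in_itv/= => /andP[Mx xM].
  rewrite lee_fin /c !normal_pdfE ?oner_neq0// ler_wpM2l ?normal_peak_ge0//.
  rewrite /normal_fun !subr0 expr1n ler_expR ler_pM2r ?invr_gt0// lerN2.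
  by rewrite ler_sqr ?nnegrE ?(le_trans M0 Mx) ?addr_ge0.
Qed.

(* The integral of [(f (x ^ 2) - f 1) (x ^ 2 - 1) >= 0] is the gap, since
   [x ^ 2 - 1] has mean zero. *)
Lemma weight_gap_gt0 : (weight_mean 1 < weight_sqr_mean 1)%R.
Proof.
pose w1 := trunc_tanh alpha beta 1.
pose w x := ((weight 1 x - w1) * (x ^+ 2 - 1))%R.
have w10 : (0 <= w1)%R by exact: trunc_tanh_ge0.
have w0 x : (0 <= w x)%R.
  rewrite /w /weight divr1; have [x1|x1] := leP 1%R (x ^+ 2)%R.
    by rewrite mulr_ge0 ?subr_ge0// le_trunc_tanh.
  by apply: mulr_le0; rewrite subr_le0 ?le_trunc_tanh ?(ltW x1).
have mX : measurable_fun [set: R] (fun x : R => x ^+ 2)%R by exact: measurable_funX.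
have mw : measurable_fun setT w.
  by apply: measurable_funM; apply: measurable_funB => //; exact: measurable_weight.
(* The constant [w1] is added to both sides to keep all integrands nonnegative. It is the integral
   of [w1] on the left and of [w1 x ^ 2] on the right. *)
have meanE : (weight_sqr_mean 1 + w1)%:E =
    (weight_mean 1 + w1)%:E + \int[gamma]_x (w x)%:E.
  rewrite !EFinD -weight_meanE -weight_sqr_meanE.
  have cE : \int[gamma]_x w1%:E = w1%:E by rewrite integral_gauss_cst.
  have c2E : \int[gamma]_x (w1 * x ^+ 2)%:E = w1%:E.
    under eq_integral do rewrite EFinM.
    rewrite ge0_integralZl_EFin//.
    - by rewrite integral_gauss_sqr mule1.
    - by move=> x _; rewrite lee_fin sqr_ge0.
    - by apply/measurable_EFinP.
  have mW1 : measurable_fun setT (weight 1) by exact: measurable_weight.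
  have mcX : measurable_fun [set: R] (fun x => w1 * x ^+ 2)%R by exact: measurable_funM.
  have W0 x : (0 <= weight 1 x)%R by exact: weight_ge0.
  have X0 x : (0 <= w1 * x ^+ 2)%R by rewrite mulr_ge0 ?sqr_ge0.
  rewrite -[in LHS]cE -[in RHS]c2E.
  rewrite -(ge0_integral_EFinD gamma (measurable_weight_sqr 1))//; last first.
    by move=> x; rewrite mulr_ge0 ?sqr_ge0.
  rewrite -(ge0_integral_EFinD gamma mW1 mcX)//.
  rewrite -(ge0_integral_EFinD gamma (measurable_funD mW1 mcX) mw)//; last first.
    by move=> x; rewrite addr_ge0.
  by apply: eq_integral => x _; congr EFin; rewrite /w /=; ring.
have [M [M0 wM]] : exists M, (0 <= M)%R /\
    forall x, (M <= x)%R -> (w M <= w x)%R /\ (0 < w M)%R.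
  (* The square of [2 + beta] exceeds both 1 and the threshold, so the weight there is strictly
     above [w1], whether [w1] is positive or truncated to 0. *)
  exists (2 + beta)%R; split => [|x Mx]; first by rewrite addr_ge0// ltW.
  have [M1 Mb] := sqr_gt_add2 beta0.
  have xM : ((2 + beta) ^+ 2 <= x ^+ 2)%R.
    have b20 : (0 <= 2 + beta)%R by rewrite addr_ge0// ltW.
    by rewrite ler_sqr ?nnegrE// (le_trans b20).
  have fM : (w1 < weight 1 (2 + beta))%R.
    rewrite /w1 /weight divr1 /trunc_tanh Mb mulr1; case: (ltP beta 1%R) => b1.
      by rewrite mulr1 lt_tanh// ltr_pM2r// invr_gt0.
    by rewrite mulr0 -tanh0 lt_tanh// divr_gt0// (lt_trans _ M1).
  have fx : (weight 1 (2 + beta) <= weight 1 x)%R.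
    by rewrite /weight !divr1 le_trunc_tanh.
  split; last by rewrite mulr_gt0 ?subr_gt0.
  by apply: ler_pM; rewrite ?subr_ge0 ?lerB// ltW.
have wint : 0 < \int[gamma]_x (w x)%:E.
  apply: (@lt_le_trans _ _ (\int[gamma]_(x in `[M, (M + 1)%R]) (w M)%:E)).
    rewrite integral_cst//= mule_gt0 ?gauss_itv_gt0// lte_fin.
    exact: (wM M (lexx _)).2.
  apply: (@le_trans _ _ (\int[gamma]_(x in `[M, (M + 1)%R]) (w x)%:E)).
    apply: ge0_le_integral => //.
    - by move=> x _; rewrite lee_fin ltW ?(wM M (lexx _)).2.
    - by apply: measurable_funTS; apply/measurable_EFinP.
    - move=> x /=; rewrite in_itv/= => /andP[Mx _].
      by rewrite lee_fin (wM x Mx).1.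
  apply: ge0_subset_integral => //; first exact/measurable_EFinP.
  by move=> x _; rewrite lee_fin.
move: wint meanE; case: (\int[gamma]_x (w x)%:E) => [r| |]//=.
by rewrite lte_fin -EFinD => r0 [] e; lra.
Qed.

Lemma weight_cvg (t : R^nat) x : (x ^+ 2)%R != beta -> t n @[n --> \oo] --> (1 : R)%R ->
  weight (t n) x @[n --> \oo] --> weight 1 x.
Proof.
move=> xb t1; rewrite /weight.
apply: (cvg_comp (fun n => x ^+ 2 / t n)%R (trunc_tanh alpha beta)).
  apply: cvgM; first exact: cvg_cst.
  apply: cvgV; last exact: t1.
  exact: oner_neq0.
rewrite divr1; exact: trunc_tanh_cvg.
Qed.

(* The weights jump where [x ^ 2 = beta], and converge pointwise elsewhere. *)
Lemma gauss_sqr_eq0 (b : R) : exists N : set R,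
  [/\ measurable N, gamma N = 0 & [set x | (x ^+ 2)%R = b] `<=` N].
Proof.
pose N := [set Num.sqrt b; - Num.sqrt b]%R.
have cN : countable N by apply: finite_set_countable; exact: finite_set2.
have mN : measurable N.
  by apply: measurableU; exact: measurable_set1.
exists N; split => //.
  have Ngamma := @normal_prob_dominates R 0 1 N; apply: Ngamma => // A mA AN.
  apply: countable_lebesgue_measure0 => //.
  by apply: sub_countable cN; exact: subset_card_le.
move=> x /= xb; have : (x ^+ 2 = Num.sqrt b ^+ 2)%R.
  by rewrite sqr_sqrtr// -xb sqr_ge0.
by move=> /eqP; rewrite eqf_sqr => /orP[] /eqP; [left|right].
Qed.

(** Dominated convergence along [t = 1 / (n + 2)], where the shift by 2 ensures [t <= 1/2]. The
    factor [1 + x ^ 2] controls the variation of both population moments at once and is itself the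
    dominating function. *)
Lemma weight_continuity (e : R) : (0 < e)%R -> exists t : R, [/\ (0 < t)%R,
  (t <= e)%R, (t <= 2^-1)%R &
  \int[gamma]_x ((weight (1 - t) x - weight (1 + t) x) * (1 + x ^+ 2))%:E <= e%:E].
Proof.
move=> e0; pose t n : R := n.+2%:R^-1%R.
pose f n x : \bar R := ((weight (1 - t n) x - weight (1 + t n) x) * (1 + x ^+ 2))%:E.
pose g x : \bar R := (1 + x ^+ 2)%:E.
have t_cvg : t n @[n --> \oo] --> (0 : R)%R.
  have := @cvg_harmonic R; rewrite -(cvg_shiftn 1); apply: cvg_trans.
  by apply: near_eq_cvg; apply: nearW => n; rewrite /harmonic/= addn1.
have mX : measurable_fun [set: R] (fun x => 1 + x ^+ 2)%R.
  by apply: measurable_funD => //; exact: measurable_funX.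
have mf n : measurable_fun setT (f n).
  apply/measurable_EFinP; apply: measurable_funM => //.
  by apply: measurable_funB; exact: measurable_weight.
have g0 (x : R) : (0 <= 1 + x ^+ 2)%R by rewrite addr_ge0// sqr_ge0.
have ig : gamma.-integrable setT g.
  apply/integrableP; split; first exact/measurable_EFinP.
  under eq_integral => x _ do rewrite gee0_abs ?lee_fin//.
  rewrite ge0_integral_EFinD//.
  - by rewrite integral_gauss_cst integral_gauss_sqr -EFinD ltry.
  by move=> x; exact: sqr_ge0.
have t0 n : (0 < t n)%R by rewrite invr_gt0.
have t1 n : (t n <= 2^-1)%R by rewrite lef_pV2 ?posrE// ler_nat.
have fg n x : `|f n x| <= g x.
  rewrite lee_fin normrM (ger0_norm (g0 x)) ler_piMl// ger0_norm.
    by rewrite lerBlDr (le_trans (weight_le1 _ _))// lerDl weight_ge0.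
  by rewrite subr_ge0 le_weight//; have := t1 n; have := t0 n; lra.
have [N [mN N0 bN]] := gauss_sqr_eq0 beta.
have [] := @dominated_convergence _ _ _ gamma setT measurableT f (cst 0) g mf _ _ ig _.
- exact: measurable_cst.
- exists N; split => // x /= nx; apply: bN; apply: contrapT => xb; apply: nx => _.
  have c1 : weight (1 - t n) x @[n --> \oo] --> weight 1 x.
    apply: weight_cvg; first exact/eqP.
    by rewrite -[X in _ --> X]subr0; apply: cvgB => //; exact: cvg_cst.
  have c2 : weight (1 + t n) x @[n --> \oo] --> weight 1 x.
    apply: weight_cvg; first exact/eqP.
    by rewrite -[X in _ --> X]addr0; apply: cvgD => //; exact: cvg_cst.
  apply: cvg_EFin; first exact: nearW.
  rewrite -[X in _ --> X](mul0r (1 + x ^+ 2)%R).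
  apply: cvgM; last exact: cvg_cst.
  by rewrite -[X in _ --> X](subrr (weight 1 x)); exact: cvgB.
- by exists set0; split => // x /= nx; apply: nx => n _; exact: fg.
move=> _ _; rewrite integral_cst// mul0e => int_cvg.
have /fine_cvgP[finN fint] := int_cvg.
have : \forall n \near \oo, (t n <= e)%R /\ \int[gamma]_x f n x <= e%:E.
  near=> n; split; first by near: n; exact: (cvgr_le _ t_cvg).
  have fin : \int[gamma]_x f n x \is a fin_num by near: n.
  by rewrite -(fineK fin) lee_fin; near: n; exact: (cvgr_le _ fint).
move=> [n _ /(_ n (leqnn n))[tn fn]].
by exists (t n).
Unshelve. all: by end_near.
Qed.

Lemma population_gap : exists2 gap : R, (0 < gap)%R & forall e : R, (0 < e)%R ->
  exists t : R, [/\ (0 < t <= e)%R, (t <= 2^-1)%R,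
    (gap <= weight_sqr_mean (1 - t) - weight_mean (1 - t))%R &
    (weight_sqr_mean (1 - t) - weight_sqr_mean (1 + t) <= e)%R].
Proof.
pose G := ((weight_sqr_mean 1 - weight_mean 1) / 2)%R.
have G0 : (0 < G)%R by rewrite divr_gt0// subr_gt0 weight_gap_gt0.
exists G => // e e0.
(* The gap at 1 is [2 G]. Both moments decrease in [rho], so each varies by at most the integral,
   and at least [G] of the gap survives at [1 - t]. *)
have [] := @weight_continuity (Num.min e G); first by rewrite lt_min e0.
move=> t [t0]; rewrite le_min => /andP[te tG] t2 int_le.
have t1 : (0 < 1 - t)%R by lra.
have tt : (1 - t <= 1 + t)%R by lra.
pose h x := ((weight (1 - t) x - weight (1 + t) x) * (1 + x ^+ 2))%R.
have h0 x : (0 <= h x)%R.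
  apply: mulr_ge0; first by rewrite subr_ge0 le_weight.
  by rewrite addr_ge0// sqr_ge0.
have mh : measurable_fun setT h.
  apply: measurable_funM.
    by apply: measurable_funB; exact: measurable_weight.
  by apply: measurable_funD => //; exact: measurable_funX.
have W0 r x : (0 <= weight r x)%R by exact: weight_ge0.
have WX0 r x : (0 <= weight r x * x ^+ 2)%R by rewrite mulr_ge0 ?sqr_ge0.
have mW r := measurable_weight r; have mWX r := measurable_weight_sqr r.
have sumE r : \int[gamma]_x (weight r x + weight r x * x ^+ 2)%:E =
    (weight_mean r + weight_sqr_mean r)%:E.
  transitivity ((weight_mean r)%:E + (weight_sqr_mean r)%:E); last by [].
  by rewrite -weight_meanE -weight_sqr_meanE; 
  exact: (ge0_integral_EFinD gamma (mW r) (mWX r) (W0 r) (WX0 r)).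
have : (weight_mean (1 - t) + weight_sqr_mean (1 - t))%:E =
    (weight_mean (1 + t) + weight_sqr_mean (1 + t))%:E + \int[gamma]_x (h x)%:E.
  rewrite -!sumE -(ge0_integral_EFinD gamma (measurable_funD (mW _) (mWX _)) mh)//.
    by apply: eq_integral => x _; congr EFin; rewrite /h /=; ring.
  by move=> x; rewrite addr_ge0.
have le_int : \int[gamma]_x (h x)%:E <= (Num.min e G)%:E by [].
have : 0 <= \int[gamma]_x (h x)%:E by apply: integral_ge0 => x _; rewrite lee_fin.
move: le_int; case: (\int[gamma]_x (h x)%:E) => [r| |]//=.
rewrite !lee_fin le_min => /andP[re rG] r0 [] sE.
have d1 := le_weight_mean t1 tt; have a1 := le_weight_sqr_mean t1 tt.
have tl : (1 - t <= 1)%R by lra.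
have tr : (1 <= 1 + t)%R by lra.
have d2 := le_weight_mean ltr01 tr; have a2 := le_weight_sqr_mean t1 tl.
have GE : (2 * G = weight_sqr_mean 1 - weight_mean 1)%R by rewrite /G; lra.
by exists t; split=> //; [rewrite t0|lra|lra].
Qed.

End population.

(** * Quadratic forms and leading eigenvectors *)

Section inner_product.
Context {R : realType} {n : nat}.
Implicit Types (u v w : 'cV[R]_n) (A : 'M[R]_n) (k : R).

Lemma innerE u v : inner u v = \sum_j u j ord0 * v j ord0.
Proof. by rewrite /inner mxE; apply: eq_bigr => j _; rewrite mxE. Qed.

Lemma innerC u v : inner u v = inner v u.
Proof. by rewrite !innerE; apply: eq_bigr => j _; rewrite mulrC. Qed.

Lemma innerDl u v w : inner (u + v) w = inner u w + inner v w.
Proof. by rewrite /inner linearD mulmxDl mxE. Qed.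

Lemma innerDr u v w : inner w (u + v) = inner w u + inner w v.
Proof. by rewrite /inner mulmxDr mxE. Qed.

Lemma innerZl k u v : inner (k *: u) v = k * inner u v.
Proof. by rewrite /inner linearZ -scalemxAl mxE. Qed.

Lemma innerZr k u v : inner u (k *: v) = k * inner u v.
Proof. by rewrite /inner -scalemxAr mxE. Qed.

Lemma innerBl u v w : inner (u - v) w = inner u w - inner v w.
Proof. by rewrite innerDl -scaleN1r innerZl mulN1r. Qed.

Lemma innerBr u v w : inner w (u - v) = inner w u - inner w v.
Proof. by rewrite innerDr -scaleN1r innerZr mulN1r. Qed.

Lemma inner_sumr I (r : seq I) (F : I -> 'cV[R]_n) u :
  inner u (\sum_(i <- r) F i) = \sum_(i <- r) inner u (F i).
Proof. by rewrite /inner mulmx_sumr summxE. Qed.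

Lemma inner_mulmxr A u v : inner u (A *m v) = inner (A^T *m u) v.
Proof. by rewrite /inner trmx_mul trmxK mulmxA. Qed.

Lemma inner_outer u v w : inner w ((u *m u^T) *m v) = inner u w * inner u v.
Proof.
rewrite -mulmxA (mx11_scalar (u^T *m v)) mul_mx_scalar innerZr mulrC.
by rewrite [inner w u]innerC.
Qed.

Lemma inner_ge0 u : 0 <= inner u u.
Proof. by rewrite innerE sumr_ge0// => j _; rewrite -expr2 sqr_ge0. Qed.

Lemma enorm_sqr u : enorm u ^+ 2 = inner u u.
Proof.
rewrite sqr_sqrtr; first by rewrite innerE; apply: eq_bigr => j _; rewrite expr2.
by apply: sumr_ge0 => j _; rewrite sqr_ge0.
Qed.

Lemma enorm_ge0 u : 0 <= enorm u.
Proof. exact: sqrtr_ge0. Qed.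

Lemma inner_eq0 u : (inner u u == 0) = (u == 0).
Proof.
apply/idP/eqP => [|->]; last by rewrite innerE big1// => j _; rewrite mxE mul0r.
rewrite innerE psumr_eq0 => [/allP u0|j _]; last by rewrite -expr2 sqr_ge0.
apply/colP => j; rewrite mxE; apply/eqP.
by have := u0 j (mem_index_enum _); rewrite /= -expr2 sqrf_eq0.
Qed.

Lemma inner_gt0 u : u != 0 -> 0 < inner u u.
Proof. by move=> u0; rewrite lt_neqAle inner_ge0 andbT eq_sym inner_eq0. Qed.

(** A crude entrywise bound, enough to make the supremum of the Rayleigh quotient finite and to
    bound the form of an inverse matrix. The added 1 makes the constant positive even for the zero
    matrix. *)
Lemma inner_mulmx_bound A : exists2 C, 0 < C &
  forall u, inner u u = 1 -> inner u (A *m u) <= C.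
Proof.
exists (1 + \sum_j \sum_k `|A j k|).
  by rewrite ltr_wpDr//; apply: sumr_ge0 => j _; apply: sumr_ge0.
move=> u u1; have uj j : `|u j ord0| <= 1.
  rewrite -(ler_pXn2r (ltn0Sn 1)) ?nnegrE// expr1n real_normK ?num_real//.
  rewrite -u1 innerE (bigD1 j)//= -expr2 lerDl.
  by apply: sumr_ge0 => k _; rewrite -expr2 sqr_ge0.
rewrite innerE -[leLHS]add0r lerD// ler_sum// => j _.
rewrite mxE mulr_sumr ler_sum// => k _.
apply: (le_trans (ler_norm _)); rewrite !normrM mulrCA ler_piMr//.
by rewrite mulr_ile1.
Qed.

(* Let [mu] be the supremum of the Rayleigh quotient. If [mu - A] were invertible,
   Cauchy-Schwarz for this semidefinite form would bound the quotient by [mu - 1/K];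
   so [mu] is an eigenvalue. *)
Lemma rayleigh_le A (lambda : R) : A^T = A ->
  (forall mu : R, eigenvalue A mu -> mu <= lambda) ->
  forall w, inner w (A *m w) <= lambda * inner w w.
Proof.
move=> symA eigA w; have [->|w0] := eqVneq w 0.
  by rewrite mulmx0 !innerE !big1 ?mulr0// => j _; rewrite mxE mul0r.
pose E := [set r | exists2 u : 'cV[R]_n, inner u u = 1 & r = inner u (A *m u)].
have normalize u : u != 0 -> exists2 v, inner v v = 1 & u = enorm u *: v.
  move=> /inner_gt0 u0; have e0 : enorm u != 0.
    by rewrite -sqrf_eq0 enorm_sqr gt_eqF.
  exists ((enorm u)^-1 *: u); last by rewrite scalerA divff// scale1r.
  by rewrite innerZl innerZr mulrA -invfM -expr2 enorm_sqr mulVf ?gt_eqF.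
have [C C0 AC] := inner_mulmx_bound A.
have supE : has_sup E.
  split; last by exists C => _ [u u1 ->]; exact: AC.
  by have [v v1 _] := normalize w w0; exists (inner v (A *m v)), v.
pose mu := sup E; pose S := mu%:M - A.
have SE u v : inner u (S *m v) = mu * inner u v - inner u (A *m v).
  by rewrite mulmxBl mul_scalar_mx innerBr innerZr.
have le_mu u : inner u (A *m u) <= mu * inner u u.
  have [->|/normalize[v v1 ->]] := eqVneq u 0.
    by rewrite mulmx0 !innerE !big1 ?mulr0// => j _; rewrite mxE mul0r.
  rewrite -scalemxAr !innerZl !innerZr v1 mulr1 -expr2 mulrA -expr2 mulrC.
  by rewrite ler_wpM2r ?sqr_ge0//; apply: ub_le_sup; [exact: supE.2|exists v].
have S0 u : 0 <= inner u (S *m u) by rewrite SE subr_ge0.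
have symS u v : inner u (S *m v) = inner v (S *m u).
  rewrite !SE innerC; congr (_ - _).
  by rewrite inner_mulmxr symA innerC.
apply: (le_trans (le_mu w)); rewrite ler_wpM2r ?inner_ge0//; apply: eigA.
have [Sunit|] := boolP (S \in unitmx); last first.
  rewrite unitmxE unitfE negbK => /det0P[v v0 vS]; apply/eigenvalueP; exists v => //.
  by apply/eqP; rewrite eq_sym -subr_eq0 -mul_mx_scalar -mulmxBr vS.
have [K K0 SK] := inner_mulmx_bound (invmx S).
have Kinv : 0 < K^-1 by rewrite invr_gt0.
suff : mu <= mu - K^-1 by lra.
apply: sup_le_ub; first exact: supE.1.
move=> _ [u u1 ->]; pose y := invmx S *m u.
have Sy : S *m y = u by rewrite /y mulmxA mulmxV// mul1mx.
(* With [S y = u] and [<y, u> <= K], expanding the form gives [<u, S u> >= 2 / K - <y, u> / K ^ 2 >=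
   1 / K], which contradicts that [mu] is the supremum. *)
have := S0 (u - K^-1 *: y).
rewrite mulmxBr -scalemxAr Sy !innerBl !innerBr !innerZl !innerZr u1.
rewrite (symS y u) Sy u1 SE u1 mulr1.
have := SK u u1; rewrite -/y innerC.
move: (inner y u) => yu yuK.
have : K^-1 * (K^-1 * yu) <= K^-1.
  by rewrite ler_piMr ?(ltW Kinv)// mulrC ler_pdivrMr// mul1r.
by lra.
Qed.

End inner_product.

Lemma inner_unit_sqr_le (R : realType) n (u d : 'cV[R]_n) :
  inner u u = 1 -> inner u d ^+ 2 <= inner d d.
Proof.
move=> u1; have := inner_ge0 (d - inner u d *: u).
by rewrite innerBl !innerBr !innerZl !innerZr u1 (innerC d u); lra.
Qed.

(** * Deterministic error analysis *)

Section alignment.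
Context {R : realType} {m n : nat}.
Variables (a : 'I_m -> 'cV[R]_n) (F : 'I_m -> R).
Hypothesis F0 : forall i, 0 <= F i.

Definition weighted_cov : 'M[R]_n := m%:R^-1 *: \sum_(i < m) F i *: (a i *m (a i)^T).

Definition weighted_quad (w : 'cV[R]_n) : R :=
  m%:R^-1 * \sum_(i < m) F i * inner (a i) w ^+ 2.

Lemma weighted_quadE w : inner w (weighted_cov *m w) = weighted_quad w.
Proof.
rewrite /weighted_cov /weighted_quad -scalemxAl innerZr mulmx_suml inner_sumr.
by congr (_ * _); apply: eq_bigr => i _; rewrite -scalemxAl innerZr inner_outer expr2.
Qed.

Lemma weighted_cov_sym : weighted_cov^T = weighted_cov.
Proof.
rewrite /weighted_cov linearZ/= linear_sum/=; congr (_ *: _).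
by apply: eq_bigr => i _; rewrite linearZ/= trmx_mul trmxK.
Qed.

Lemma weighted_quad_ge0 w : 0 <= weighted_quad w.
Proof.
rewrite mulr_ge0 ?invr_ge0// sumr_ge0// => i _.
by rewrite mulr_ge0 ?sqr_ge0.
Qed.

(** Young's inequality in each summand: the difference of the two sides is
    [(eta q - (p - q)) ^ 2 / eta]. *)
Lemma weighted_quad_perturb (eta : R) (v w : 'cV[R]_n) : 0 < eta ->
  weighted_quad v <= (1 + eta) * weighted_quad w + (1 + eta^-1) * weighted_quad (v - w).
Proof.
move=> eta0; rewrite /weighted_quad (mulrCA (1 + eta)) (mulrCA (1 + eta^-1)) -mulrDr.
rewrite ler_wpM2l ?invr_ge0// !mulr_sumr -big_split/= ler_sum// => i _.
rewrite (mulrCA (1 + eta)) (mulrCA (1 + eta^-1)) -mulrDr ler_wpM2l// innerBr.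
move: (inner (a i) v) (inner (a i) w) => p q; rewrite -subr_ge0.
have -> : (1 + eta) * q ^+ 2 + (1 + eta^-1) * (p - q) ^+ 2 - p ^+ 2 =
    (eta * q - (p - q)) ^+ 2 / eta.
  by field; rewrite gt_eqF.
by rewrite divr_ge0 ?sqr_ge0// ltW.
Qed.

Variables (u v v0 : 'cV[R]_n) (AL AU DU eps eta gap : R).

Lemma leading_eigenvector_align :
  inner u u = 1 -> inner v v = 1 -> is_leading_eigenvector weighted_cov v ->
  inner v0 v0 <= 1 -> inner (v - v0) (v - v0) <= eta ^+ 2 ->
  0 < eta <= 4^-1 -> 0 <= eps -> 0 < gap -> gap <= AU - DU -> AL <= 1 ->
  AL - eps <= weighted_quad u ->
  weighted_quad v0 <= DU + inner u v0 ^+ 2 * (AU - DU) + eps ->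
  (1 - inner u v0 ^+ 2) * gap <= AU - AL + 2 * eps + 3 * eta.
Proof.
move=> u1 v1 [_ [lambda Yv eigY]] v01 vv0 /andP[eta0 eta4] eps0 gap0 gapD AL1 ALu Qv0.
have ray := rayleigh_le weighted_cov_sym eigY.
have lamE : weighted_quad v = lambda.
  by rewrite -weighted_quadE Yv innerZr v1 mulr1.
have lam0 : 0 <= lambda by rewrite -lamE weighted_quad_ge0.
have lamu : AL - eps <= lambda.
  by apply: (le_trans ALu); have := ray u; rewrite u1 mulr1 weighted_quadE.
have Qlam : weighted_quad v0 <= lambda.
  have := ray v0; rewrite weighted_quadE => /le_trans; apply.
  by rewrite ler_piMr.
have Qd : weighted_quad (v - v0) <= lambda * eta ^+ 2.
  have := ray (v - v0); rewrite weighted_quadE => /le_trans; apply.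
  by rewrite ler_wpM2l.
have := weighted_quad_perturb v v0 eta0; rewrite lamE.
have : (1 + eta^-1) * weighted_quad (v - v0) <= (1 + eta^-1) * (lambda * eta ^+ 2).
  by rewrite ler_wpM2l// addr_ge0// invr_ge0 ltW.
have -> : (1 + eta^-1) * (lambda * eta ^+ 2) = lambda * (eta ^+ 2 + eta).
  by field; rewrite gt_eqF.
have := le_trans (inner_unit_sqr_le v0 u1) v01.
move: (weighted_quad v0) (weighted_quad (v - v0)) (inner u v0 ^+ 2) Qv0 Qlam Qd.
move=> Q Q' c2 Qv0 Qlam Qd c21 h1 h2.
(* The form is at most [lambda eta ^ 2] at [v - v0] and at most [lambda] at [v0], so moving from [v]
   to [v0] loses [lambda (2 eta + eta ^ 2)]. *)
have h3 : lambda * (1 - 3 * eta) <= Q.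
  have : lambda * (1 - eta - eta ^+ 2) <= Q + eta * lambda by nra.
  have : lambda * eta ^+ 2 <= lambda * eta by rewrite ler_wpM2l// expr2 ler_piMr; lra.
  by nra.
have h4 : (AL - eps) * (1 - 3 * eta) <= lambda * (1 - 3 * eta).
  by rewrite ler_wpM2r//; lra.
(* [AL <= 1] turns the relative loss into an additive one. *)
have h5 : AL - eps - 3 * eta <= (AL - eps) * (1 - 3 * eta) by nra.
have h6 : (1 - c2) * (AU - DU) <= AU - AL + 2 * eps + 3 * eta by lra.
by apply: le_trans h6; rewrite ler_wpM2l// subr_ge0.
Qed.

End alignment.

(** With [s = sqrt tau] and [p = <u, v>], the squared error is [r ^ 2 ((s - 1) ^ 2 + 2 s (1 - p))].
    The first term is at most [t], and [s <= 2] produces the constant 4. *)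
Lemma spectral_estimate (R : realType) n (u v v0 : 'cV[R]_n)
    (r tau t kappa eta delta : R) :
  inner u u = 1 -> inner v v = 1 -> inner v0 v0 <= 1 ->
  inner (v - v0) (v - v0) <= eta ^+ 2 -> 0 < r -> 0 < t <= 2^-1 ->
  1 - t <= tau <= 1 + t -> 0 < eta -> 1 - inner u v0 ^+ 2 <= kappa ->
  0 <= delta -> t + 4 * (kappa + eta) <= delta ^+ 2 ->
  let z := Num.sqrt (r ^+ 2 * tau) *: v in
  enorm (z - r *: u) <= enorm (z + r *: u) ->
  enorm (z - r *: u) <= delta * enorm (r *: u).
Proof.
move=> u1 v1 v01 vv0 r0 /andP[t0 t2] /andP[tau1 tau2] eta0 c1 delta0 dE z.
have sqrt_le (p q : R) : 0 <= q -> p ^+ 2 <= q ^+ 2 -> p <= q.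
  move=> q0 pq; have [p0|p0] := leP 0 p; last by rewrite (le_trans (ltW p0)).
  by rewrite -(ler_pXn2r (ltn0Sn 1)).
have tau0 : 0 < tau by lra.
pose s := Num.sqrt tau.
have s0 : 0 < s by rewrite sqrtr_gt0.
have s2 : s ^+ 2 = tau by rewrite sqr_sqrtr// ltW.
have zE : z = (r * s) *: v.
  by rewrite /z sqrtrM ?sqr_ge0// sqrtr_sqr gtr0_norm.
move=> /(fun h => ler_pM (enorm_ge0 _) (enorm_ge0 _) h h).
rewrite -!expr2 !enorm_sqr zE !(innerBl, innerBr, innerDl, innerDr).
rewrite !innerZl !innerZr u1 v1 (innerC v u) => zx.
pose p := inner u v.
have rs : 0 < r * s by rewrite mulr_gt0.
(* The choice of the global sign, squared, says exactly this. *)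
have p0 : 0 <= p.
  have : 0 <= (r * s) * (r * p) by rewrite /p; lra.
  by rewrite pmulr_rge0// pmulr_rge0.
have pc : `|p - inner u v0| <= eta.
  rewrite -(ler_pXn2r (ltn0Sn 1)) ?nnegrE ?(ltW eta0)// real_normK ?num_real//.
  by rewrite -innerBr; apply: le_trans vv0; exact: inner_unit_sqr_le.
have c2 : inner u v0 ^+ 2 <= 1 by apply: le_trans v01; exact: inner_unit_sqr_le.
(* If [c = <u, v0>] is nonnegative, then [1 - c <= 1 - c ^ 2]; if it is negative,
   [c ^ 2 <= - c <= eta - p]. *)
have p1 : 1 - p <= kappa + eta.
  move: pc c1 c2; rewrite ler_norml; move: (inner u v0) => c /andP[pc1 pc2] c1 c2.
  by have [c0|c0] := leP 0 c; nra.
have s1 : (s - 1) ^+ 2 <= t.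
  have : (s - 1) * (s + 1) = tau - 1 by rewrite -s2; ring.
  have : (tau - 1) ^+ 2 <= t ^+ 2 by nra.
  have : t ^+ 2 <= t by nra.
  move=> tt taut e; apply: le_trans tt; apply: le_trans taut; rewrite -e exprMn.
  by rewrite ler_peMr ?sqr_ge0// -[leLHS](expr1n _ 2) ler_sqr ?nnegrE; lra.
have s22 : s <= 2 by nra.
apply: sqrt_le; first by rewrite mulr_ge0 ?enorm_ge0.
rewrite exprMn !enorm_sqr !(innerBl, innerBr) !innerZl !innerZr u1 v1 (innerC v u).
rewrite -/p mulr1.
apply: (@le_trans _ _ (r ^+ 2 * ((s - 1) ^+ 2 + 2 * s * (1 - p)))).
  by rewrite le_eqVlt; apply/orP; left; apply/eqP; ring.
rewrite [leRHS](_ : _ = r ^+ 2 * delta ^+ 2); last by ring.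
rewrite ler_wpM2l ?sqr_ge0//; apply: le_trans dE.
have : s * (1 - p) <= 2 * (kappa + eta).
  have ke : 0 <= kappa + eta by lra.
  by have [p11|p11] := leP 0 (1 - p); nra.
by lra.
Qed.

Section deterministic.
Context {R : realType} {m n : nat}.
Variables (alpha beta : R) (a : 'I_m -> 'cV[R]_n) (u : 'cV[R]_n) (r : R).
Hypotheses (alpha0 : 0 < alpha) (beta0 : 0 < beta) (r0 : 0 < r).
Hypothesis u1 : inner u u = 1.
Let g i := inner (a i) u.
Let tau := m%:R^-1 * \sum_i g i ^+ 2.
Let y i := `|inner (a i) (r *: u)| ^+ 2.

Lemma sample_meanE : sample_mean y = r ^+ 2 * tau.
Proof.
rewrite /sample_mean /tau mulrCA; congr (_ * _); rewrite mulr_sumr.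
by apply: eq_bigr => i _; rewrite /y innerZr normrM exprMn !real_normK ?num_real.
Qed.

(** The weights depend only on the ratios of the [y i] to their mean, so the scale [r ^ 2]
    cancels. *)
Lemma tanh_spectral_mxE : 0 < tau -> tanh_spectral_mx alpha beta y a =
  weighted_cov a (fun i => weight alpha beta tau (g i)).
Proof.
move=> tau0; rewrite /tanh_spectral_mx /weighted_cov; congr (_ *: _).
apply: eq_bigr => i _; congr (_ *: _).
rewrite sample_meanE /weight /trunc_tanh.
have yE : y i = r ^+ 2 * g i ^+ 2.
  by rewrite /y innerZr normrM exprMn !real_normK ?num_real.
have r20 : 0 < r ^+ 2 by rewrite exprn_gt0.
congr (tanh _ * _%:R).
  rewrite yE; field; rewrite !gt_eqF//.
by rewrite yE mulrCA ltr_pM2l// ltr_pdivlMr.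
Qed.

(** Isolates what probability has to supply: the range of [tau], one lower bound and one upper bound
    per net point, each about a sum whose [i]-th term involves [a i] alone. *)
Lemma tanh_spectral_success (t eta eps e gap delta : R) (net : 'cV[R]_n -> Prop) :
  let AU := weight_sqr_mean alpha beta (1 - t) in
  let AL := weight_sqr_mean alpha beta (1 + t) in
  let DU := weight_mean alpha beta (1 - t) in
  0 < t <= 2^-1 -> 0 < eta <= 4^-1 -> 0 <= eps -> 0 < gap -> gap <= AU - DU ->
  AU - AL <= e -> 0 <= delta ->
  t + 4 * ((e + 2 * eps + 3 * eta) / gap + eta) <= delta ^+ 2 ->
  1 - t <= tau <= 1 + t ->
  AL - eps <= m%:R^-1 * \sum_i weight alpha beta (1 + t) (g i) * g i ^+ 2 ->
  (forall v0, net v0 -> m%:R^-1 *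
     \sum_i weight alpha beta (1 - t) (g i) * inner (a i) v0 ^+ 2 <=
     DU + inner u v0 ^+ 2 * (AU - DU) + eps) ->
  (forall v, inner v v = 1 -> exists v0, [/\ net v0, inner v0 v0 <= 1 &
     inner (v - v0) (v - v0) <= eta ^+ 2]) ->
  forall z, tanh_spectral_output alpha beta y a z ->
    enorm (z - r *: u) <= enorm (z + r *: u) ->
    enorm (z - r *: u) <= delta * enorm (r *: u).
Proof.
move=> AU AL DU t12 eta01 eps0 gap0 gapD AUL delta0 dE tau12 lowA upQ netP z.
have [/andP[t0 t2] /andP[tau1 tau2]] := (t12, tau12).
have tau0 : 0 < tau by lra.
have minv : 0 <= (m%:R : R)^-1 by rewrite invr_ge0.
case=> v [v1 vlead zE]; rewrite tanh_spectral_mxE// in vlead.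
have {}v1 : inner v v = 1 by rewrite -enorm_sqr v1 expr1n.
have [v0 [nv0 v01 vv0]] := netP v v1.
rewrite sample_meanE in zE; rewrite zE.
apply: (spectral_estimate (t := t) (kappa := (e + 2 * eps + 3 * eta) / gap)
  u1 v1 v01 vv0) => //.
  by case/andP: eta01.
have F0 i : 0 <= weight alpha beta tau (g i) by exact: weight_ge0.
rewrite ler_pdivlMr//.
apply: le_trans (leading_eigenvector_align F0 u1 v1 vlead v01 vv0 eta01 eps0 gap0
  gapD (weight_sqr_mean_le1 alpha0 beta0 (1 + t)) _ _) _.
- apply: (le_trans lowA); rewrite /weighted_quad ler_wpM2l// ler_sum// => i _.
  by rewrite ler_wpM2r ?sqr_ge0// le_weight.
- apply: (le_trans _ (upQ _ nv0)); rewrite /weighted_quad ler_wpM2l// ler_sum// => i _.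
  by rewrite ler_wpM2r ?sqr_ge0// le_weight//; lra.
- by rewrite -/AU -/AL; lra.
Qed.

End deterministic.

(** * A net of the unit ball *)

Section grid_net.
Context {R : realType} {n : nat}.
Variables (eta : R) (N : nat).
Hypotheses (n0 : (0 < n)%N) (eta0 : 0 < eta) (etaN : 1 <= eta ^+ 2 * N%:R).

(** Sign and magnitude of each coordinate in units of [eta / sqrt n]. A grid point of the unit ball
    has squared magnitudes summing to at most [n / eta ^ 2 <= N n], which bounds the range of
    each. *)
Definition grid_index := {ffun 'I_n -> bool * 'I_(N * n).+1}.

Let h := eta / Num.sqrt n%:R.

Definition grid_point (f : grid_index) : 'cV[R]_n :=
  \col_j ((-1) ^+ (f j).1 * ((f j).2%:R * (eta / Num.sqrt n%:R))).

Definition grid_net : {set grid_index} :=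
  [set f : grid_index | inner (grid_point f) (grid_point f) <= 1]%SET.

Let n0R : 0 < (n%:R : R). Proof. by rewrite ltr0n. Qed.
Let h0 : 0 < h. Proof. by rewrite divr_gt0// sqrtr_gt0. Qed.
Let h2 : h ^+ 2 = eta ^+ 2 / n%:R.
Proof. by rewrite expr_div_n sqr_sqrtr// ltW. Qed.

Let inner_grid f : inner (grid_point f) (grid_point f) =
  (\sum_j (f j).2%:R ^+ 2) * h ^+ 2.
Proof.
rewrite innerE mulr_suml; apply: eq_bigr => j _.
by rewrite !mxE -expr2 exprMn sqrr_sign mul1r exprMn.
Qed.

Let sqr_bound (k : R) : k * h ^+ 2 <= 1 -> k <= (N * n)%:R.
Proof.
rewrite h2 mulrA ler_pdivrMr// mul1r natrM => kn.
have e20 : 0 < eta ^+ 2 by rewrite exprn_gt0.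
rewrite -(ler_pM2r e20); apply: (le_trans kn).
by rewrite mulrAC -[leLHS]mul1r ler_wpM2r ?(ltW n0R)// mulrC.
Qed.

Let nat_sqr (k : nat) : k%:R <= k%:R ^+ 2 :> R.
Proof. by rewrite -natrX ler_nat; case: k => // k; rewrite expnS leq_pmulr ?expn_gt0. Qed.

(* A net point with coordinates [k_j] (in units of [h]) has
   [\sum_j k_j <= \sum_j k_j ^ 2 <= N n], hence [1 <= 2 ^ (N n) \prod_j 2 ^ - k_j],
   and the sum of the right-hand sides over all indices factorizes. *)
Lemma card_grid_net : #|grid_net|%:R <= (2 ^ N * 4)%:R ^+ n :> R.
Proof.
pose q : R := 2^-1.
have q0 : 0 < q by rewrite invr_gt0.
have geom K : \sum_(k < K) q ^+ k <= 2.
  suff : \sum_(k < K) q ^+ k = 2 - 2 * q ^+ K.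
    by move=> ->; rewrite gerBl mulr_ge0// exprn_ge0// ltW.
  elim: K => [|K IH]; first by rewrite big_ord0 expr0; lra.
  by rewrite big_ord_recr/= IH exprS /q; lra.
have -> : #|grid_net|%:R = \sum_(f in grid_net) 1 :> R.
  by rewrite sumr_const.
apply: (@le_trans _ _ (\sum_(f : grid_index) 2 ^+ (N * n) * \prod_j q ^+ (f j).2)).
  rewrite [leRHS](bigID (mem grid_net))/= -[leLHS]addr0 lerD//; last first.
    apply: sumr_ge0 => f _; rewrite mulr_ge0 ?exprn_ge0// prodr_ge0// => j _.
    by rewrite exprn_ge0// ltW.
  apply: ler_sum => f; rewrite inE inner_grid => /sqr_bound fN.
  rewrite -expr_sum /q exprVn ler_pdivlMr ?exprn_gt0// mul1r.
  rewrite ler_weXn2l// ?ler1n// -(ler_nat R) natr_sum; apply: le_trans fN.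
  by apply: ler_sum.
rewrite -mulr_sumr natrM natrX exprMn -exprM ler_wpM2l ?exprn_ge0//.
rewrite -(bigA_distr_bigA (fun=> fun p : bool * 'I_(N * n).+1 => q ^+ p.2))/=.
rewrite prodr_const card_ord; apply: lerXn2r; rewrite ?nnegrE//.
  by apply: sumr_ge0 => p _; rewrite exprn_ge0// ltW.
(* The two signs double a geometric sum that is at most 2, hence the factor 4 per coordinate. *)
rewrite -(pair_bigA _ (fun b k => q ^+ (k : 'I_(N * n).+1)))/= big_bool/=.
by have := geom (N * n).+1; lra.
Qed.

(* Rounding every coordinate towards zero does not leave the unit ball. *)
Lemma grid_net_cover (v : 'cV[R]_n) : inner v v = 1 -> exists f,
  [/\ f \in grid_net & inner (v - grid_point f) (v - grid_point f) <= eta ^+ 2].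
Proof.
move=> v1; pose k j := Num.truncn (`|v j ord0| / h).
have kP j : (k j)%:R * h <= `|v j ord0| < (k j).+1%:R * h.
  rewrite -ler_pdivlMr// -ltr_pdivrMr//.
  by apply: Num.Theory.truncn_itv; rewrite divr_ge0// ltW.
have v2 j : v j ord0 ^+ 2 <= 1.
  rewrite -v1 innerE (bigD1 j)//= -expr2 lerDl.
  by apply: sumr_ge0 => i _; rewrite -expr2 sqr_ge0.
have kh j : (k j)%:R ^+ 2 * h ^+ 2 <= v j ord0 ^+ 2.
  rewrite -exprMn -(real_normK (num_real (v j ord0))).
  have [/andP[kv _] khj] := (kP j, mulr_ge0 (ler0n R (k j)) (ltW h0)).
  by rewrite ler_sqr ?nnegrE.
have kN j : (k j < (N * n).+1)%N.
  rewrite ltnS -(ler_nat R); apply: (le_trans (nat_sqr _)); apply: sqr_bound.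
  exact: le_trans (kh j) (v2 j).
pose f : grid_index := [ffun j => (v j ord0 < 0, Ordinal (kN j))].
exists f; split.
  rewrite inE inner_grid -[leRHS]v1 innerE mulr_suml ler_sum// => j _.
  by rewrite ffunE/= -expr2 kh.
have -> : eta ^+ 2 = \sum_(j < n) h ^+ 2.
  by rewrite sumr_const card_ord h2 -[RHS]mulr_natr divfK// gt_eqF.
rewrite innerE ler_sum// => j _; rewrite -expr2 !mxE ffunE/= -/h.
have /andP[k1 k2] := kP j.
have -> : (v j ord0 - (-1) ^+ (v j ord0 < 0)%R * ((k j)%:R * h)) ^+ 2 =
    (`|v j ord0| - (k j)%:R * h) ^+ 2.
  by case: ltP => vj; [rewrite ltr0_norm//|rewrite ger0_norm//]; ring.
rewrite ler_sqr ?nnegrE ?subr_ge0 ?(ltW h0)//.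
by move: k2; rewrite -natr1 mulrDl mul1r; lra.
Qed.

End grid_net.

(** * The success event *)

Section sample_moments.
Local Open Scope ereal_scope.
Context d (T : measurableType d) (R : realType) (P : probability T R) (n : nat).
Variables (X : T -> n.-tuple R).
Hypothesis gaussX : standard_gaussian_vector P X.
Local Notation gamma := (normal_prob (0 : R) 1).
Implicit Types u v w : 'cV[R]_n.

Definition linform u (s : n.-tuple R) : R := inner (col_of_tuple s) u.

Lemma measurable_linform u : measurable_fun setT (linform u).
Proof.
rewrite (_ : linform u = fun s => (\sum_j tnth s j * u j ord0)%R).
  apply: measurable_sum => j; apply: measurable_funM => //.
  exact: measurable_tnth.
by apply/funext => s; rewrite /linform innerE; apply: eq_bigr => j _; rewrite mxE.
Qed.

Lemma linformE u : (fun s => linform u (X s)) =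
  fun s => dot (fun j => u j ord0) (fun j => tnth (X s) j).
Proof.
apply/funext => s; rewrite /linform innerE; apply: eq_bigr => j _.
by rewrite mxE mulrC.
Qed.

Lemma ge0_integral_linform_pair u w (F : R * R -> \bar R) :
  inner u u = 1%R -> inner u w = 0%R -> measurable_fun setT F ->
  (forall p, 0 <= F p) ->
  \int[P]_s F (linform u (X s), linform w (X s)) =
  \int[gamma]_x \int[gamma]_y F (x, enorm w * y)%R.
Proof.
move=> u1 uw mF F0; have nX := normal_family_gaussian_vector gaussX.
have dotE v v' : dot (fun j => v j ord0) (fun j => v' j ord0) = inner v v'.
  by rewrite innerE.
rewrite (_ : enorm w = Num.sqrt (dot (fun j => w j ord0) (fun j => w j ord0))).
  rewrite -(ge0_integral_gauss_pair (u := fun j => u j ord0) nX _ _ mF F0) ?dotE//.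
  apply: eq_integral => s _.
  have /(congr1 (@^~ s)) /= -> := linformE u.
  by have /(congr1 (@^~ s)) /= -> := linformE w.
by rewrite dotE -enorm_sqr sqrtr_sqr ger0_norm// enorm_ge0.
Qed.

Lemma ge0_integral_linform u (f : R -> \bar R) : inner u u = 1%R ->
  measurable_fun setT f -> (forall x, 0 <= f x) ->
  \int[P]_s f (linform u (X s)) = \int[gamma]_x f x.
Proof.
move=> u1 mf f0; have mF : measurable_fun setT (fun p : R * R => f p.1).
  exact: measurableT_comp.
have u0 : inner u 0 = 0%R by rewrite /inner mulmx0 mxE.
rewrite (@ge0_integral_linform_pair u 0 (fun p => f p.1) u1 u0 mF (fun=> f0 _)).
by apply: eq_integral => x _; exact: (@integral_gauss_cst R (f x)).
Qed.

Lemma linform_decomp u v : inner u u = 1%R -> let c := inner u v in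
  let w := (v - c *: u)%R in
  [/\ inner u w = 0%R, (inner v v = c ^+ 2 + enorm w ^+ 2)%R &
    forall s, linform v s = (c * linform u s + linform w s)%R].
Proof.
move=> u1 c w; split.
- by rewrite /w innerBr innerZr u1 mulr1 subrr.
- rewrite enorm_sqr /w !(innerBl, innerBr) !innerZl !innerZr u1 (innerC v u) -/c.
  by ring.
- by move=> s; rewrite /linform /w innerBr innerZr; ring.
Qed.

Let s8 : R := (Num.sqrt (1 - 2 * 8^-1))^-1%R.

(** [<a, v>] has the law of [c x + q y] with [c ^ 2 + q ^ 2 <= 1], so its square is dominated by
    [x ^ 2 + y ^ 2] and the moment by [s8 ^ 2 = (1 - 2/8) ^ (-1) = 4/3]. *)
Lemma linform_mgf u v (Z : n.-tuple R -> R) : inner u u = 1%R ->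
  (inner v v <= 1)%R -> measurable_fun setT Z ->
  (forall s, `|Z s| <= linform v s ^+ 2)%R ->
  \int[P]_s (expR (8^-1 * `|Z (X s)|))%:E <= (4 / 3)%:E.
Proof.
move=> u1 v1 mZ Zv.
have [uw vE linformv] := linform_decomp v u1.
move: (inner u v) (v - _)%R uw vE linformv => c w uw vE linformv.
have mX : measurable_fun setT X.
  apply/measurable_fun_tnthP => i; exact: gaussX.1.1.
pose e (x : R) := expR (8^-1 * x ^+ 2).
have me : measurable_fun setT e.
  by apply: measurableT_comp => //; apply: measurable_funM.
have e0 x : (0 <= e x)%R by exact: expR_ge0.
pose F (p : R * R) := (e p.1 * e p.2)%:E.
have mF : measurable_fun setT F.
  by apply/measurable_EFinP/measurable_funM; exact: measurableT_comp.
have F0 p : 0 <= F p by rewrite lee_fin mulr_ge0.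
pose G (p : R * R) := (expR (8^-1 * (c * p.1 + p.2) ^+ 2))%:E.
have mG : measurable_fun setT G.
  apply/measurable_EFinP/measurableT_comp => //; apply: measurable_funM => //.
  by apply: measurable_funX; apply: measurable_funD => //; exact: measurable_funM.
have G0 p : 0 <= G p by rewrite lee_fin expR_ge0.
apply: (@le_trans _ _ (\int[P]_s G (linform u (X s), linform w (X s)))).
  apply: ge0_le_integral => //.
  - apply/measurable_EFinP/measurableT_comp => //; apply: measurable_funM => //.
    by apply: measurableT_comp => //; exact: measurableT_comp.
  - apply: (measurableT_comp mG); apply: measurable_fun_pair.
      by apply: measurableT_comp => //; exact: measurable_linform.
    by apply: measurableT_comp => //; exact: measurable_linform.
  - by move=> s _; rewrite /G lee_fin ler_expR ler_pM2l//= -linformv.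
rewrite (ge0_integral_linform_pair u1 uw mG G0).
have mH : measurable_fun setT (fun p : R * R => G (p.1, enorm w * p.2)%R).
  apply: (measurableT_comp mG); apply: measurable_fun_pair => //=.
  exact: measurable_funM.
have mG' x : measurable_fun setT (fun y : R => G (x, enorm w * y)%R).
  apply: (measurableT_comp mG); apply: measurable_fun_pair => //;
    exact: measurable_funM.
have mF' x : measurable_fun setT (fun y : R => F (x, y)).
  by apply: (measurableT_comp mF); exact: measurable_fun_pair.
apply: (@le_trans _ _ (\int[gamma]_x \int[gamma]_y F (x, y))).
  apply: ge0_le_integral => //.
  - by move=> x _; apply: integral_ge0.
  - exact: (@measurable_fun_fubini_tonelli_F _ _ _ _ _ gamma _ mH (fun=> G0 _)).
  - exact: (@measurable_fun_fubini_tonelli_F _ _ _ _ _ gamma _ mF F0).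
  - move=> x _; apply: ge0_le_integral => //; [exact: mG'|exact: mF'|move=> y _].
    rewrite lee_fin /e -expRD ler_expR -mulrDr ler_pM2l//=.
    (* Lagrange's identity: this square is the defect in the Cauchy-Schwarz inequality for
       [c x + q y]. *)
    have : (0 <= (c * y - enorm w * x) ^+ 2)%R by exact: sqr_ge0.
    rewrite vE in v1.
    have : ((c ^+ 2 + enorm w ^+ 2) * (x ^+ 2 + y ^+ 2) <= x ^+ 2 + y ^+ 2)%R.
      by rewrite ler_piMl// addr_ge0 ?sqr_ge0.
    move: (enorm w) => q; nra.
have s2 : (s8 * s8 = 4 / 3)%R.
  have e34 : (1 - 2 * 8^-1 = 3 / 4 :> R)%R by lra.
  by rewrite /s8 e34 -expr2 exprVn sqr_sqrtr ?invf_div//; lra.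
have intE : \int[gamma]_x (e x)%:E = s8%:E.
  by apply: integral_gauss_expR_sqr; lra.
have s80 : (0 <= s8)%R by rewrite invr_ge0.
have intF x : \int[gamma]_y F (x, y) = (s8 * e x)%:E.
  rewrite [LHS](ge0_integral_EFinZl gamma (e0 x) me e0) intE.
  by rewrite mulrC.
under eq_integral do rewrite intF.
by rewrite [leLHS](ge0_integral_EFinZl gamma s80 me e0) intE -EFinM s2.
Qed.

(** The weight involves only the component along [u]. Integrating out the orthogonal component
    removes the cross term and leaves [c ^ 2 x ^ 2 + q ^ 2]. *)
Lemma weighted_linform_mean alpha beta rho u v : (0 < alpha)%R -> (0 < beta)%R ->
  inner u u = 1%R ->
  \int[P]_s (weight alpha beta rho (linform u (X s)) * linform v (X s) ^+ 2)%:E =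
  (inner u v ^+ 2 * weight_sqr_mean alpha beta rho +
   (inner v v - inner u v ^+ 2) * weight_mean alpha beta rho)%:E.
Proof.
move=> alpha0 beta0 u1; have [uw vE linformv] := linform_decomp v u1.
rewrite vE (addrC (_ ^+ 2)%R) addrK.
move: (inner u v) (v - _)%R uw vE linformv => c w uw vE linformv.
pose W := weight alpha beta rho.
have W0 x : (0 <= W x)%R by exact: weight_ge0.
have mW : measurable_fun setT W by exact: measurable_weight.
pose G (p : R * R) := (W p.1 * (c * p.1 + p.2) ^+ 2)%:E.
have mG : measurable_fun setT G.
  apply/measurable_EFinP; apply: measurable_funM; first exact: measurableT_comp.
  by apply: measurable_funX; apply: measurable_funD => //; exact: measurable_funM.
have G0 p : 0 <= G p by rewrite lee_fin mulr_ge0 ?sqr_ge0.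
transitivity (\int[P]_s G (linform u (X s), linform w (X s))).
  by apply: eq_integral => s _; rewrite /G/= linformv.
rewrite (ge0_integral_linform_pair u1 uw mG G0).
set q := enorm w.
have mA (a b : R) : measurable_fun [set: R] (fun y : R => (a + b * y) ^+ 2)%R.
  by apply: measurable_funX; apply: measurable_funD => //; exact: measurable_funM.
have intG x : \int[gamma]_y G (x, q * y)%R =
    (c ^+ 2 * (W x * x ^+ 2) + q ^+ 2 * W x)%:E.
  rewrite [LHS](ge0_integral_EFinZl gamma (W0 x) (mA (c * x)%R q) (fun=> sqr_ge0 _)).
  by rewrite integral_gauss_affine_sqr -EFinM; congr EFin; ring.
under eq_integral do rewrite intG.
have mWX : measurable_fun setT (fun x => W x * x ^+ 2)%R by exact: measurable_weight_sqr.
have WX0 x : (0 <= W x * x ^+ 2)%R by rewrite mulr_ge0 ?sqr_ge0.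
have mZ (k : R) (f : R -> R) : measurable_fun setT f ->
    measurable_fun setT (fun x => k * f x)%R.
  by move=> mf; exact: measurable_funM.
rewrite (ge0_integral_EFinD gamma (mZ _ _ mWX) (mZ _ _ mW)); last 2 first.
- by move=> x; rewrite mulr_ge0 ?sqr_ge0.
- by move=> x; rewrite mulr_ge0 ?sqr_ge0.
rewrite (ge0_integral_EFinZl gamma (sqr_ge0 c) mWX WX0).
rewrite (ge0_integral_EFinZl gamma (sqr_ge0 q) mW W0).
by rewrite weight_meanE// weight_sqr_meanE.
Qed.

End sample_moments.

(** * Union bound and choice of the constants *)

Lemma union_bound d (T : measurableType d) (R : realType) (P : probability T R)
    (I : finType) (A : {set I}) (B : I -> set T) (p : R) :
  (forall i, i \in A -> measurable (B i) /\ (P (B i) <= p%:E)%E) ->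
  measurable (\big[setU/set0]_(i in A) B i) /\
  (P (\big[setU/set0]_(i in A) B i) <= (#|A|%:R * p)%:E)%E.
Proof.
move=> BP; rewrite mulr_natl -sumr_const -sumEFin.
elim/big_rec2: _ => [|i y S iA [mS PS]]; first by rewrite measure0.
have [mB PB] := BP i iA; split; first exact: measurableU.
by apply: (le_trans (measureU2 _ mB mS)); exact: leeD.
Qed.

(** [3 + B ^ n <= (4 B) ^ n <= expR (4 B n)], and the sample size makes [4 B n < c1 m / 2]. The
    remaining rate [c1 / 2] is strictly better than [c1 / 4]. *)
Lemma failure_prob_lt (R : realType) (c1 B : R) (n m : nat) :
  0 < c1 -> 1 <= B -> (0 < n)%N -> 8 * B / c1 * n%:R < m%:R ->
  (3 + B ^+ n) * expR (- (c1 * m%:R)) < expR (- (c1 / 4 * m%:R)).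
Proof.
move=> c10 B1 n0 nm.
have B0 : 0 < B by lra.
have nR : 0 < n%:R :> R by rewrite ltr0n.
have mR : 0 < m%:R :> R.
  by apply: le_lt_trans nm; rewrite mulr_ge0// divr_ge0 ?(ltW c10)// mulr_ge0 ?(ltW B0).
have Bn : 1 <= B ^+ n by rewrite exprn_ege1.
have h1 : 3 + B ^+ n <= (4 * B) ^+ n.
  have h4 : 4 <= 4 ^+ n :> R by rewrite -[leLHS]expr1 ler_weXn2l//; lra.
  by rewrite exprMn; nra.
have h2 : (4 * B) ^+ n <= expR (4 * B * n%:R).
  rewrite expRM_natr; apply: lerXn2r; rewrite ?nnegrE ?expR_ge0 ?mulr_ge0 ?(ltW B0)//.
  by apply: le_trans (expR_ge1Dx _); lra.
have h3 : 4 * B * n%:R < c1 / 2 * m%:R.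
  move: nm; rewrite mulrAC ltr_pdivrMr//; lra.
apply: (@le_lt_trans _ _ (expR (4 * B * n%:R) * expR (- (c1 * m%:R)))).
  by rewrite ler_pM2r ?expR_gt0// (le_trans h1).
have : 0 < c1 * m%:R by rewrite mulr_gt0.
by rewrite -expRD ltr_expR; lra.
Qed.

(** One number [q] serves as net radius and as tolerance for [AU - AL], while [t] is also the
    deviation. For [t <= q] the left-hand side is at most [q (5 + 24 / gap)], whence [D]. *)
Lemma accuracy_parameter (R : realType) (gap delta : R) : 0 < gap -> 0 < delta ->
  exists2 q : R, 0 < q <= 4^-1 & forall t : R, t <= q ->
    t + 4 * ((q + 2 * t + 3 * q) / gap + q) <= delta ^+ 2.
Proof.
move=> gap0 delta0; pose D := 5 + 24 / gap.
have g0 : 0 < gap^-1 by rewrite invr_gt0.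
have D0 : 0 < D by rewrite /D; lra.
exists (Num.min 4^-1 (delta ^+ 2 / D)).
  by rewrite lt_min ge_min lexx !divr_gt0 ?exprn_gt0// invr_gt0 ltr0n.
move=> t; set q := Num.min _ _ => tq.
have qD : q * D <= delta ^+ 2 by rewrite -ler_pdivlMr// ge_min lexx orbT.
apply: le_trans qD; rewrite /D.
have : t * gap^-1 <= q * gap^-1 by rewrite ler_pM2r.
by lra.
Qed.

Theorem theorem4 (R : realType) (alpha beta delta : R)
    (halpha : 0 < alpha) (hbeta : 0 < beta) (hdelta : 0 < delta) :
  exists c0 c : R, 0 < c0 /\ 0 < c /\
    forall (n m : nat) (d : measure_display) (T : measurableType d)
      (P : probability T R) (x : 'cV[R]_n) (a : 'I_m -> {RV P >-> n.-tuple R}),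
      x != 0 ->
      mutually_independent P (fun i w => a i w) ->
      (forall i, standard_gaussian_vector P (a i)) ->
      c0 * n%:R < m%:R ->
      with_probability_exceeding P (1 - expR (- (c * m%:R)))
        [set w |
          let av := fun i => col_of_tuple (a i w) in
          let y := fun i => `|inner (av i) x| ^+ 2 in
          forall z0 : 'cV[R]_n,
            tanh_spectral_output alpha beta y av z0 ->
            enorm (z0 - x) <= enorm (z0 + x) ->
            enorm (z0 - x) <= delta * enorm x].
Proof.
(* The order matters: [gap] depends on [alpha] and [beta], [q] on [gap] and [delta], and [t] on [q].
   All are fixed before [n] and [m], and so are the [N], [c1] and [B] built from them. *)
have [gap gap0 gapP] := population_gap halpha hbeta.
have [q /andP[q0 q4] qP] := accuracy_parameter gap0 hdelta.
have [t [/andP[t0 tq] t2 gapU AUL]] := gapP q q0.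
pose N := Num.bound (q ^+ 2)^-1.
have qN : 1 <= q ^+ 2 * N%:R.
  rewrite mulrC -ler_pdivrMr ?exprn_gt0// mul1r ltW//.
  by apply: archi_boundP; rewrite invr_ge0 sqr_ge0.
pose K : R := 4 / 3.
have K0 : 0 < K by rewrite /K; lra.
have kappa0 : 0 < 8^-1 :> R by rewrite invr_gt0.
pose c1 := chernoff_tilt 8^-1 K t * t / 2.
have c10 : 0 < c1.
  by rewrite /c1 divr_gt0// mulr_gt0// chernoff_tilt_gt0.
pose B : R := (2 ^ N * 4)%:R.
have B1 : 1 <= B by rewrite ler1n muln_gt0 expn_gt0.
exists (8 * B / c1), (c1 / 4); split; first by rewrite divr_gt0// mulr_gt0//; lra.
split; first by rewrite divr_gt0.
move=> n m d T P x a x0 inda gaussa nm.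
have n0 : (0 < n)%N.
  by case: n x {a inda gaussa nm} x0 => // x; rewrite (flatmx0 x) eqxx.
have m0 : (0 < m)%N.
  rewrite -(ltr0n R); apply: le_lt_trans nm.
  by rewrite mulr_ge0// divr_ge0 ?(ltW c10)// mulr_ge0//; lra.
have mR : 0 < m%:R :> R by rewrite ltr0n.
pose r := enorm x.
have r0 : 0 < r.
  by rewrite lt_neqAle enorm_ge0 eq_sym -sqrf_eq0 enorm_sqr inner_eq0 x0.
pose u := r^-1 *: x.
have xE : x = r *: u by rewrite /u scalerA divff ?scale1r// gt_eqF.
have u1 : inner u u = 1.
  by rewrite /u innerZl innerZr -enorm_sqr -/r; field; rewrite gt_eqF.
pose L := weight alpha beta (1 + t); pose U := weight alpha beta (1 - t).
pose AU := weight_sqr_mean alpha beta (1 - t).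
pose AL := weight_sqr_mean alpha beta (1 + t).
pose DU := weight_mean alpha beta (1 - t).
pose bad (Z : n.-tuple R -> R) (mu : R) :=
  [set w | m%:R * (mu + t) <= \sum_i Z (a i w)].
have badP (Z : n.-tuple R -> R) (mu : R) (v : 'cV[R]_n) : measurable_fun setT Z ->
    inner v v <= 1 -> (forall s, `|Z s| <= linform v s ^+ 2) ->
    (forall i, \int[P]_w (Z (a i w))%:E <= mu%:E)%E ->
    measurable (bad Z mu) /\ (P (bad Z mu) <= (expR (- (c1 * m%:R)))%:E)%E.
  move=> mZ v1 Zv Zmu.
  apply: (chernoff_bound (K := K) inda mZ kappa0 K0 t0 _ Zmu) => i.
  exact: (linform_mgf (gaussa i) u1 v1 mZ Zv).
have mp (v : 'cV[R]_n) : measurable_fun setT (linform (R := R) v).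
  exact: measurable_linform.
have mp2 (v : 'cV[R]_n) : measurable_fun setT (fun s => linform v s ^+ 2).
  exact: measurable_funX.
have mW rho : measurable_fun setT (weight alpha beta rho) by exact: measurable_weight.
have W0 rho z : 0 <= weight alpha beta rho z by exact: weight_ge0.
have W1 rho z : weight alpha beta rho z <= 1 by exact: weight_le1.
(* [Z1] and [Z2] keep [tau] within [t] of [1], [Z3] bounds the top eigenvalue from
   below, and the [Z4 f] bound the quadratic form from above on the net. *)
pose Z1 (s : n.-tuple R) := linform u s ^+ 2.
pose Z2 (s : n.-tuple R) := - linform u s ^+ 2.
pose Z3 (s : n.-tuple R) := - (L (linform u s) * linform u s ^+ 2).
pose Z4 f (s : n.-tuple R) := U (linform u s) * linform (grid_point (N := N) q f) s ^+ 2.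
(* The exact mean for a net point, whose norm may be below 1; the bound with [DU] in the
   deterministic part follows because that norm is at most 1 and [DU >= 0]. *)
pose mu4 f := inner u (grid_point (N := N) q f) ^+ 2 * AU +
  (inner (grid_point (N := N) q f) (grid_point (N := N) q f)
   - inner u (grid_point (N := N) q f) ^+ 2) * DU.
have int1 i : (\int[P]_w (linform u (a i w) ^+ 2)%:E = 1)%E.
  have mX : measurable_fun [set: R] (fun z => (z ^+ 2)%:E).
    by apply/measurable_EFinP; exact: measurable_funX.
  rewrite -(integral_gauss_sqr (R := R)).
  apply: (ge0_integral_linform (gaussa i) u1 mX) => z.
  by rewrite lee_fin sqr_ge0.
have [mB1 PB1] : measurable (bad Z1 1) /\
    (P (bad Z1 1%R) <= (expR (- (c1 * m%:R)))%:E)%E.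
  apply: (badP _ _ u) => //; first exact: mp2.
  - by rewrite u1.
  - by move=> s; rewrite ger0_norm ?sqr_ge0.
  - by move=> i; rewrite int1.
have [mB2 PB2] : measurable (bad Z2 (-1)) /\
    (P (bad Z2 (-1)%R) <= (expR (- (c1 * m%:R)))%:E)%E.
  apply: (badP _ _ u) => //.
  - by apply: measurableT_comp => //; exact: mp2.
  - by rewrite u1.
  - by move=> s; rewrite normrN ger0_norm ?sqr_ge0.
  - move=> i; under eq_integral do rewrite EFinN.
    by rewrite integral_ge0N ?int1// => w _; rewrite lee_fin sqr_ge0.
have [mB3 PB3] : measurable (bad Z3 (- AL)) /\
    (P (bad Z3 (- AL)%R) <= (expR (- (c1 * m%:R)))%:E)%E.
  apply: (badP _ _ u) => //.
  - apply: measurableT_comp => //; apply: measurable_funM; last exact: mp2.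
    exact: (measurableT_comp (mW _) (mp u)).
  - by rewrite u1.
  - move=> s; rewrite normrN (ger0_norm (mulr_ge0 (W0 _ _) (sqr_ge0 _))).
    by apply: ler_piMl; [exact: sqr_ge0|exact: W1].
  - move=> i; under eq_integral do rewrite EFinN.
    rewrite integral_ge0N => [|w _]; last exact: (mulr_ge0 (W0 _ _) (sqr_ge0 _)).
    have := weighted_linform_mean (gaussa i) (1 + t) u halpha hbeta u1.
    by rewrite u1 expr1n subrr mul0r mul1r addr0 => ->.
pose net := grid_net (n := n) q N.
have [mB4 PB4] : measurable (\big[setU/set0]_(f in net) bad (Z4 f) (mu4 f)) /\
    (P (\big[setU/set0]_(f in net) bad (Z4 f) (mu4 f)) <=
     (#|net|%:R * expR (- (c1 * m%:R)))%:E)%E.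
  apply: union_bound => f; rewrite inE => f1.
  apply: (badP _ _ (grid_point q f)) => //.
  - apply: measurable_funM; last exact: mp2.
    exact: (measurableT_comp (mW _) (mp u)).
  - move=> s; rewrite (ger0_norm (mulr_ge0 (W0 _ _) (sqr_ge0 _))).
    by apply: ler_piMl; [exact: sqr_ge0|exact: W1].
  - by move=> i; rewrite (weighted_linform_mean (gaussa i)).
pose p := expR (- (c1 * m%:R)).
pose Bad := bad Z1 1 `|` bad Z2 (-1) `|` bad Z3 (- AL) `|`
  \big[setU/set0]_(f in net) bad (Z4 f) (mu4 f).
have mB12 := measurableU _ _ mB1 mB2; have mB123 := measurableU _ _ mB12 mB3.
have mBad : measurable Bad by exact: measurableU.
have PBad : (P Bad <= ((3 + B ^+ n) * p)%:E)%E.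
  apply: (@le_trans _ _ (p%:E + p%:E + p%:E + (#|net|%:R * p)%:E)%E).
    apply: (le_trans (measureU2 P mB123 mB4)); apply: leeD => //.
    apply: (le_trans (measureU2 P mB12 mB3)); apply: leeD => //.
    by apply: (le_trans (measureU2 P mB1 mB2)); exact: leeD.
  rewrite -!EFinD lee_fin.
  have := card_grid_net n0 q0 qN; rewrite -/B => cardB.
  have : #|net|%:R * p <= B ^+ n * p by rewrite ler_pM2r ?expR_gt0.
  by lra.
exists (~` Bad); split.
- exact: measurableC.
- move=> w nBad av y z zout zx.
  have m_lt S mu : ~ (m%:R * (mu + t) <= S) -> m%:R^-1 * S < mu + t.
    by move=> /negP; rewrite -ltNge => h; rewrite mulrC ltr_pdivrMr// mulrC.
  have nB1 : m%:R^-1 * \sum_i Z1 (a i w) < 1 + t.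
    by apply: m_lt => h; apply: nBad; do 3 left.
  have nB2 : m%:R^-1 * \sum_i Z2 (a i w) < -1 + t.
    by apply: m_lt => h; apply: nBad; do 2 left; right.
  have nB3 : m%:R^-1 * \sum_i Z3 (a i w) < - AL + t.
    by apply: m_lt => h; apply: nBad; left; right.
  have nB4 f : f \in net -> m%:R^-1 * \sum_i Z4 f (a i w) < mu4 f + t.
    move=> fnet; apply: m_lt => h; apply: nBad; right.
    by rewrite -bigcup_pred; exists f.
  have success := (tanh_spectral_success (alpha := alpha) (beta := beta)
    (a := av) (t := t) (eta := q) (eps := t) (e := q) (gap := gap)
    (net := fun v => exists2 f, f \in net & v = grid_point q f) halpha hbeta
    r0 u1).
  have zout' : tanh_spectral_output alpha beta
    (fun i => `|inner (av i) (r *: u)| ^+ 2) av z by rewrite -xE.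
  rewrite xE in zx *; apply: (success delta _ _ _ _ _ _ _ _ _ _ _ _ z zout' zx).
  - by rewrite t0 t2.
  - by rewrite q0 q4.
  - exact: ltW.
  - exact: gap0.
  - exact: gapU.
  - exact: AUL.
  - exact: ltW.
  - exact: qP.
  - have Z2E : \sum_i Z2 (a i w) = - \sum_i Z1 (a i w) by rewrite -sumrN.
    rewrite -[m%:R^-1 * _]/(m%:R^-1 * \sum_i Z1 (a i w)); move: nB1 nB2.
    rewrite Z2E mulrN; move: (_ * _) => tau h1 h2.
    by apply/andP; split; lra.
  - pose Z3' (s : n.-tuple R) := L (linform u s) * linform u s ^+ 2.
    have Z3E : \sum_i Z3 (a i w) = - \sum_i Z3' (a i w) by rewrite -sumrN.
    rewrite -[m%:R^-1 * _]/(m%:R^-1 * \sum_i Z3' (a i w)); move: nB3.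
    by rewrite Z3E mulrN -/AL; move: (_ * _) => A3 h; lra.
  - move=> _ [f fnet ->]; apply: (le_trans (ltW (nB4 f fnet))).
    rewrite lerD2r /mu4; move: fnet; rewrite inE => f1.
    have DU0 : 0 <= DU by exact: weight_mean_ge0.
    have : inner (grid_point q f) (grid_point q f) * DU <= DU by rewrite ler_piMl.
    by rewrite /DU /AU; lra.
  - move=> v v1; have [f [fnet vf]] := grid_net_cover n0 q0 qN v1.
    exists (grid_point q f); split => //; first by exists f.
    by move: fnet; rewrite inE.
- rewrite probability_setC//.
  have finBad : P Bad \is a fin_num by exact: fin_num_measure.
  rewrite -(fineK finBad) -EFinB lte_fin ltrD2l ltrN2.
  apply: (@le_lt_trans _ _ ((3 + B ^+ n) * p)); first by rewrite -lee_fin fineK.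
  exact: failure_prob_lt.
Qed.
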